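(* Let $\mathcal{T}$ be a tiling of the plane built from congruent copies (reflected copies allowed) of the marked prototile $T$ defined in the context and obeying rule R1 of the context. Then the marked arcs of the tiles of $\mathcal{T}$ generate a continuous self-avoiding curve reaching each tile, and hence $\mathcal{T}$ (as a marked tiling) cannot be periodic: no translation by a nonzero vector is a symmetry of $\mathcal{T}$.
   Context: Tilings: a plane tiling is a countable family of sets (tiles) covering the plane without gaps or overlaps of non-zero area. All tiles considered are closed topological disks and uniformly bounded. The prototile $T$: let $H$ be a regular heptagon with consecutive vertices $v_0,\dots,v_6$. The boundary of $T$ consists of the four edges of $H$ along the path $v_0v_1v_2v_3v_4$ (the convex side) together with the image of the three-edge path $v_4v_5v_6v_0$ under reflection in the line through $v_0$ and $v_4$ (the concave side). $T$ is the closed region bounded by this polygon with seven edges. Its inner angles are $\pi/7$ at $v_0$ and $v_4$, $5\pi/7$ at the three vertices $v_1,v_2,v_3$ of the convex side, and $9\pi/7$ at the two interior vertices of the concave side. Marking: $T$ carries a fixed marked arc, a simple arc of finite length lying in the interior of $T$ except for its two endpoints, which are a vertex of $T$ with inner angle $5\pi/7$ on the convex side and a vertex of $T$ with inner angle $9\pi/7$ on the concave side. Every copy of $T$ (direct or reflected) carries the corresponding image of this arc as its marked arc. Rule R1: a single copy of $T$ is placed anywhere in the plane as the seed (starting set) and the other tiles are added one by one in a sequence, in such a way that each additionally placed tile continuously connects with its marked arc to a marked arc of an already placed tile. That is, the tiles of the tiling can be enumerated $T_0,T_1,T_2,\dots$ so that for each $n\ge 1$ an endpoint of the marked arc of $T_n$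 coincides with an endpoint of the marked arc of $T_j$ for some $j<n$. A continuous self-avoiding curve of arcs means that the marked arcs are joined end to end in a single sequence, with union the image of an interval of $\mathbb{R}$ under an injective continuous map. A symmetry of the marked tiling is an isometry of the plane that maps tiles to tiles and marked arcs to marked arcs. In the paper, nonperiodic means the lack of any (nonzero) translational symmetry. *)

(* Defs.v *)
From HB Require Import structures.
From mathcomp Require Import all_boot all_order all_algebra.
From mathcomp Require Import all_classical all_reals all_analysis.

Set Implicit Arguments.
Unset Strict Implicit.
Unset Printing Implicit Defensive.

Import Order.TTheory GRing.Theory Num.Theory.
Import numFieldNormedType.Exports.

Local Open Scope classical_set_scope.
Local Open Scope ring_scope.

(* The plane is R * R.  The library norm on R * R is the sup norm: it is used
   only for the topology and for boundedness, where the choice of norm does not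
   matter.  Lengths and isometries use the Euclidean distance edist. *)
Notation plane R := (R * R)%type.

Section Plane.
Variable R : realType.
Implicit Types (p q a b : plane R) (A B : set (plane R)).

Definition dotp p q : R := p.1 * q.1 + p.2 * q.2.

Definition edist p q : R := Num.sqrt (dotp (p - q) (p - q)).

Definition plane_isometry (f : plane R -> plane R) :=
  forall p q, edist (f p) (f q) = edist p q.

Definition area A : \bar R :=
  ((@lebesgue_measure R) \x (@lebesgue_measure R))%E A.

Definition segment a b : set (plane R) :=
  [set (1 - t) *: a + t *: b | t in `[0, 1]].

Definition polyline (s : seq (plane R)) : set (plane R) :=
  [set p | exists2 i, (i.+1 < size s)%N & segment s`_i s`_i.+1 p].

(* Orthogonal reflection in the line through a and b, for a != b. *)
Definition reflection a b p : plane R :=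
  a + (2 * dotp (p - a) (b - a) / dotp (b - a) (b - a)) *: (b - a) - (p - a).

(* B together with the bounded components of its complement. *)
Definition enclosed_region B : set (plane R) :=
  B `|` [set p | ~ B p /\ bounded_set (connected_component (~` B) p)].

(* Seven points equally spaced on a circle, listed consecutively in one of the
   two possible directions; any centre, radius and phase are allowed. *)
Definition regular_heptagon (v : nat -> plane R) :=
  exists (c : plane R) (r theta : R) (clockwise : bool), 0 < r /\
    forall k, (k < 7)%N ->
      let phi := theta + (-1) ^+ clockwise * (k%:R * (2 * pi / 7)) in
      v k = c + r *: (cos phi, sin phi).

Section Prototile.
Variable v : nat -> plane R.

Definition prototile_boundary : set (plane R) :=
  polyline [:: v 0%N; v 1%N; v 2%N; v 3%N; v 4%N]
  `|` reflection (v 0%N) (v 4%N) @` polyline [:: v 4%N; v 5%N; v 6%N; v 0%N].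

Definition prototile : set (plane R) := enclosed_region prototile_boundary.

Definition convex_vertices : set (plane R) := [set v 1%N; v 2%N; v 3%N].

Definition concave_vertices : set (plane R) :=
  [set reflection (v 0%N) (v 4%N) (v 5%N); reflection (v 0%N) (v 4%N) (v 6%N)].

End Prototile.

Definition arc_parametrization (g : R -> plane R) A :=
  [/\ {within `[0, 1], continuous g},
      {in `[0, 1] &, injective g} & g @` `[0, 1] = A].

(* Sums run over the subdivisions 0 = s_0 < ... < s_n = 1 of [0, 1], the list s
   omitting s_0. *)
Definition finite_length (g : R -> plane R) :=
  exists L : R, forall s : seq R, itv_partition 0 1 s ->
    \sum_(0 <= i < size s)
      edist (g (nth 1 (0 :: s) i)) (g (nth 1 (0 :: s) i.+1)) <= L.

Definition arc_endpoint A p :=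
  exists g, arc_parametrization g A /\ (p = g 0 \/ p = g 1).

Definition is_marking (v : nat -> plane R) A :=
  exists g, [/\ arc_parametrization g A, finite_length g,
    convex_vertices v (g 0), concave_vertices v (g 1) &
    forall t : R, 0 < t < 1 -> (prototile v)° (g t)].

Record marked_tile := MarkedTile {
  tile_region : set (plane R);
  tile_arc : set (plane R) }.

Definition tile_image (f : plane R -> plane R) (t : marked_tile) :=
  MarkedTile (f @` tile_region t) (f @` tile_arc t).

Implicit Type T : set marked_tile.

Definition plane_tiling T :=
  [/\ countable T,
      \bigcup_(t in T) tile_region t = setT &
      forall t u, T t -> T u -> t <> u ->
        area (tile_region t `&` tile_region u) = 0%E].

(* Isometries of the plane include the orientation-reversing ones. *)
Definition tiled_by_copies (t0 : marked_tile) T :=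
  forall t, T t -> exists2 f, plane_isometry f & t = tile_image f t0.

Definition rule_R1 T :=
  exists s : nat -> marked_tile, set_bij setT T s /\
    forall n, (0 < n)%N -> exists2 j, (j < n)%N &
      exists p, arc_endpoint (tile_arc (s n)) p /\
                arc_endpoint (tile_arc (s j)) p.

(* The arcs of the tiles of T are joined end to end in a single sequence, with
   union C the image of an interval J under an injective continuous map c.  The
   sequence is indexed by an interval K of integers (finite, one-way or two-way
   infinite), and c is parametrized so that it runs through the k-th arc during
   [k, k + 1]. *)
Definition arcs_form_self_avoiding_curve T (C : set (plane R)) :=
  exists (K : set int) (s : int -> marked_tile) (J : set R) (c : R -> plane R),
    [/\ [/\ forall i j k : int, K i -> K k -> i <= j <= k -> K j,
            set_bij K T s,
            is_interval J &
            J = \bigcup_(k in K) [set` `[k%:~R : R, (k + 1)%:~R]]],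
        {within J, continuous c},
        {in J &, injective c},
        forall k, K k -> c @` [set` `[k%:~R : R, (k + 1)%:~R]] = tile_arc (s k) &
        c @` J = C /\ C = \bigcup_(t in T) tile_arc t].

Definition marked_symmetry (f : plane R -> plane R) T :=
  plane_isometry f /\ forall t, T t -> T (tile_image f t).

Definition nonperiodic T :=
  forall w : plane R, w != 0 -> ~ marked_symmetry (fun p => p + w) T.

End Plane.

(* Main.v *)
From mathcomp Require Import all_boot all_order all_algebra.
From mathcomp Require Import all_classical all_reals all_analysis.
From mathcomp Require Import ring lra zify.
Require Import Defs.

Set Implicit Arguments.
Unset Strict Implicit.
Unset Printing Implicit Defensive.

Import Order.TTheory GRing.Theory Num.Theory.
Import numFieldNormedType.Exports.

Local Open Scope classical_set_scope.
Local Open Scope ring_scope.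

(** The endpoints of a marked arc are vertices of its tile with inner angle
    5 pi / 7 or 9 pi / 7. Since 3 * 5 pi / 7 > 2 pi, at most two arcs end at a
    point of the plane. Quantitatively, at such a vertex the interior of the tile
    contains a sector of angle 2 pi / 3 with some slack (prototile_wide_corner),
    and among three unit vectors two have a scalar product at least - 1 / 2, so
    that two of three such sectors overlap (three_wide_corners). Two tiles whose
    interiors meet overlap in positive area (area_interiors_disjoint). As
    the other points of an arc are interior to its tile, two arcs can only meet at
    endpoints.

    By rule R1 the arcs added one by one therefore extend a chain at one of its
    two ends (chain_extend). In the limit the chain is indexed by an infinite
    interval of integers (chain_exists), and two of its arcs meet only where they
    are joined (chain_simple): a coincidence of its two extreme points would need
    a first and a last arc. Running through the arcs one after the other gives the
    self-avoiding curve (concatenation_curve).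

    A translation by w <> 0 which is a symmetry preserves the incidence of arcs,
    so that it acts on the index interval by an injective map preserving
    adjacency; it moves each tile, and so does its square, because tiles are
    bounded. Such a map is k |-> k + m with m <> 0 (adjacency_translation). Each
    tile is then a translate, by a multiple of w, of one of finitely many tiles,
    so that the tiling lies in a strip parallel to w and does not cover the plane
    (tiling_nonperiodic).

    The tile is defined by the bounded components of the complement of its
    boundary; to know its interior near the vertices, an explicit bounded open
    polygonal region is shown to be closed in the complement of the boundary, hence
    to be contained in the tile (sub_enclosed_region). *)

(** * Isometries of the plane and wide corners *)

Section Isometries.
Variable R : realType.
Implicit Types (p q d u : plane R) (A B : set (plane R)) (f g : plane R -> plane R).

Lemma isometry_dotp f p q : plane_isometry f ->
  dotp (f p - f q) (f p - f q) = dotp (p - q) (p - q).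
Proof.
have dotp_ge0 x : 0 <= dotp x x by rewrite /dotp addr_ge0// -expr2 sqr_ge0.
move=> /(_ p q) /(congr1 (fun x => x ^+ 2)).
by rewrite /edist !sqr_sqrtr ?dotp_ge0.
Qed.

Lemma dotp_isometry f :
  (forall p q, dotp (f p - f q) (f p - f q) = dotp (p - q) (p - q)) ->
  plane_isometry f.
Proof. by move=> fE p q; rewrite /edist fE. Qed.

(** In coordinates a plane isometry is a rotation, possibly preceded by the
    reflection in the first axis, followed by a translation. *)
Lemma isometry_coords f : plane_isometry f ->
  exists a b tau : R, exists q, [/\ a ^+ 2 + b ^+ 2 = 1, tau ^+ 2 = 1 &
    forall p, f p = q + (a * p.1 - tau * b * p.2, b * p.1 + tau * a * p.2)].
Proof.
move=> /isometry_dotp fE.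
pose h p : plane R := f p - f 0.
have hh p : dotp (h p) (h p) = dotp p p by rewrite /h fE subr0.
have hd p q : dotp (h p) (h q) = dotp p q.
  have : dotp (h p - h q) (h p - h q) = dotp (p - q) (p - q).
    rewrite -(fE p q); suff -> : h p - h q = f p - f q by [].
    by rewrite /h opprB addrA subrK.
  have := hh p; have := hh q; rewrite /dotp /=; lra.
case hA : (h (1, 0)) => [a b]; case hB : (h (0, 1)) => [x y].
have AA := hd (1, 0) (1, 0); have BB := hd (0, 1) (0, 1).
have AB := hd (1, 0) (0, 1).
rewrite hA hB /dotp /= in AA AB BB.
pose tau := a * y - b * x.
have xE : x = - tau * b.
  rewrite /tau; transitivity ((a * a + b * b) * x); first by rewrite AA; ring.
  have -> : (a * a + b * b) * x = a * (a * x + b * y) - b * (a * y - b * x) by ring.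
  by rewrite AB; ring.
have yE : y = tau * a.
  rewrite /tau; transitivity ((a * a + b * b) * y); first by rewrite AA; ring.
  have -> : (a * a + b * b) * y = b * (a * x + b * y) + a * (a * y - b * x) by ring.
  by rewrite AB; ring.
have tau2 : tau ^+ 2 = 1.
  transitivity (tau ^+ 2 * (a * a + b * b)); first by rewrite AA; ring.
  transitivity (x * x + y * y); first by rewrite xE yE; ring.
  by rewrite BB; ring.
exists a, b, tau, (f 0); split=> //; first by rewrite !expr2 AA; ring.
move=> p; have := hd p (1, 0); have := hd p (0, 1); rewrite hA hB.
have -> : f p = f 0 + h p by rewrite /h addrC subrK.
case: (h p) => z w; rewrite /dotp /= xE yE => eB eA.
congr (_ + (_, _)).
- transitivity ((a * a + b * b) * z); first by rewrite AA; ring.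
  transitivity (a * (z * a + w * b) + tau ^+ 2 * (b * b * z - a * b * w)).
    by rewrite tau2; ring.
  transitivity (a * (z * a + w * b) - tau * b * (z * (- tau * b) + w * (tau * a))).
    by ring.
  by rewrite eA eB; ring.
- transitivity ((a * a + b * b) * w); first by rewrite AA; ring.
  transitivity (b * (z * a + w * b) + tau ^+ 2 * (a * a * w - a * b * z)).
    by rewrite tau2; ring.
  transitivity (b * (z * a + w * b) + tau * a * (z * (- tau * b) + w * (tau * a))).
    by ring.
  by rewrite eA eB; ring.
Qed.

Lemma linear_coords_continuous (a b c d : R) q :
  continuous (fun p : plane R => q + (a * p.1 + b * p.2, c * p.1 + d * p.2)).
Proof.
move=> p; apply: cvgD; first exact: cvg_cst.
have lin (x y : R) : (fun p : plane R => x * p.1 + y * p.2) @ p --> x * p.1 + y * p.2.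
  by apply: cvgD; apply: cvgM; [exact: cvg_cst | exact: cvg_fst
    | exact: cvg_cst | exact: cvg_snd].
exact: cvg_pair (lin a b) (lin c d).
Qed.

Lemma isometry_continuous f : plane_isometry f -> continuous f.
Proof.
move=> /isometry_coords[a [b [tau [q [_ _ fE]]]]].
have -> : f = fun p => q + (a * p.1 + (- (tau * b)) * p.2, b * p.1 + tau * a * p.2).
  by apply/funext => p; rewrite fE mulNr.
exact: linear_coords_continuous.
Qed.

Lemma isometry_inverse f : plane_isometry f ->
  exists g, [/\ plane_isometry g, cancel f g & cancel g f].
Proof.
move=> /[dup] /isometry_dotp fE /isometry_coords[a [b [tau [q [ab tau2 fq]]]]].
pose g p : plane R := (a * (p.1 - q.1) + b * (p.2 - q.2),
  tau * (a * (p.2 - q.2) - b * (p.1 - q.1))).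
have gK : cancel g f.
  move=> p; rewrite fq /g; apply: injective_projections => /=.
  - transitivity (q.1 + a ^+ 2 * (p.1 - q.1) + a * b * (p.2 - q.2) -
      tau ^+ 2 * (a * b * (p.2 - q.2) - b ^+ 2 * (p.1 - q.1))); first by ring.
    rewrite tau2; transitivity (q.1 + (a ^+ 2 + b ^+ 2) * (p.1 - q.1)); first by ring.
    by rewrite ab; ring.
  - transitivity (q.2 + b ^+ 2 * (p.2 - q.2) + a * b * (p.1 - q.1) +
      tau ^+ 2 * (a ^+ 2 * (p.2 - q.2) - a * b * (p.1 - q.1))); first by ring.
    rewrite tau2; transitivity (q.2 + (a ^+ 2 + b ^+ 2) * (p.2 - q.2)); first by ring.
    by rewrite ab; ring.
have fK : cancel f g.
  move=> p; rewrite fq /g; apply: injective_projections => /=.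
  - transitivity ((a ^+ 2 + b ^+ 2) * p.1); first by ring.
    by rewrite ab; ring.
  - transitivity (tau ^+ 2 * (a ^+ 2 + b ^+ 2) * p.2); first by ring.
    by rewrite ab tau2; ring.
exists g; split=> //; apply: dotp_isometry => x y.
by rewrite -fE !gK.
Qed.

Lemma isometry_interior f A : plane_isometry f -> f @` A° `<=` (f @` A)°.
Proof.
move=> fi; have [g [gi fK gK]] := isometry_inverse fi.
move=> _ [p Ap <-].
have gA : nbhs (g (f p)) A by rewrite fK.
have h : nbhs (f p) (g @^-1` A) := isometry_continuous gi gA.
by apply: (filterS _ h) => x Ax; exists (g x) => //; rewrite gK.
Qed.

Lemma isometry_closed f A : plane_isometry f -> closed A -> closed (f @` A).
Proof.
move=> fi clA; have [g [gi fK gK]] := isometry_inverse fi.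
have -> : f @` A = g @^-1` A.
  by apply/seteqP; split=> [_ [p Ap <-]|p Ap] /=; [rewrite fK|exists (g p)].
by move/continuous_closedP: (isometry_continuous gi); apply.
Qed.

(** The linear part of an isometry preserves scalar products. *)
Lemma isometry_diff f p q d : plane_isometry f ->
  dotp (f (p + d) - f p) (f (p + q) - f p) = dotp d q.
Proof.
move=> /isometry_coords[a [b [tau [w [ab tau2 fE]]]]].
rewrite !fE /dotp /=.
transitivity ((a ^+ 2 + b ^+ 2) * (d.1 * q.1 + tau ^+ 2 * (d.2 * q.2))); first by ring.
by rewrite ab tau2; ring.
Qed.

Lemma isometry_line f p d (e : R) : plane_isometry f ->
  f (p + e *: d) = f p + e *: (f (p + d) - f p).
Proof.
move=> /isometry_coords[a [b [tau [w [ab tau2 fE]]]]].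
by rewrite !fE; apply: injective_projections => /=; rewrite /GRing.scale/=; ring.
Qed.

End Isometries.

Section WideCorners.
Variable R : realType.
Implicit Types (p q d u : plane R) (A B C : set (plane R)).

(** Near the point p, the interior of A contains the closed sector of angle
    2 pi / 3 with apex p and axis u: every direction d making an angle at most
    pi / 3 with u points into the interior. *)
Definition sector_at A p u := forall d, 0 < dotp d u ->
  dotp d d <= 4 * dotp d u ^+ 2 ->
  exists2 delta : R, 0 < delta & forall e, 0 < e < delta -> A° (p + e *: d).

(** Some such sector exists at p. *)
Definition wide_corner A p := exists2 u, dotp u u = 1 & sector_at A p u.

(** The condition on the scalar product says that the axes u and w make an angle
    at most 2 pi / 3. *)
Lemma sectors_meet A B p u w : dotp u u = 1 -> dotp w w = 1 ->
  - 1 / 2 <= dotp u w -> sector_at A p u -> sector_at B p w ->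
  A° `&` B° !=set0.
Proof.
move=> u1 w1 uw Au Bw.
(* The bisector of u and w makes with each an angle of at most pi / 3. *)
pose d := u + w.
have du : dotp d u = 1 + dotp u w by rewrite -u1 /d /dotp /=; ring.
have dw : dotp d w = 1 + dotp u w by rewrite -w1 /d /dotp /=; ring.
have dd : dotp d d = 2 + 2 * dotp u w.
  by move: u1 w1; rewrite /d /dotp /=; lra.
have [| |x x0 Ax] := Au d; rewrite ?du ?dd; [lra|nra|].
have [| |y y0 By] := Bw d; rewrite ?dw ?dd; [lra|nra|].
have m0 : 0 < Num.min x y by rewrite lt_min x0 y0.
exists (p + (Num.min x y / 2) *: d); split.
- by apply: Ax; rewrite divr_gt0//= ltr_pdivrMr// ; have := ge_min x x y; rewrite lexx /=; lra.
- by apply: By; rewrite divr_gt0//= ltr_pdivrMr// ; have := ge_min y x y; rewrite lexx orbT /=; lra.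
Qed.

(** Of three sectors of angle 2 pi / 3 with the same apex, two have axes at an
    angle at most 2 pi / 3, and these two have a common ray. *)
Lemma three_wide_corners A B C p :
  wide_corner A p -> wide_corner B p -> wide_corner C p ->
  [\/ A° `&` B° !=set0, A° `&` C° !=set0 | B° `&` C° !=set0].
Proof.
move=> [u u1 Au] [v v1 Bv] [w w1 Cw].
have : 0 <= dotp (u + v + w) (u + v + w) by rewrite addr_ge0// -expr2 sqr_ge0.
have -> : dotp (u + v + w) (u + v + w) =
    dotp u u + dotp v v + dotp w w + 2 * (dotp u v + dotp u w + dotp v w).
  by rewrite /dotp /=; ring.
rewrite u1 v1 w1 => sum_ge0.
have [uv|uv] := leP (- 1 / 2) (dotp u v); first by apply: Or31; exact: sectors_meet Au Bv.
have [uw|uw] := leP (- 1 / 2) (dotp u w); first by apply: Or32; exact: sectors_meet Au Cw.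
by apply: Or33; apply: sectors_meet Bv Cw => //; lra.
Qed.

Lemma wide_corner_isometry f A p : plane_isometry f ->
  wide_corner A p -> wide_corner (f @` A) (f p).
Proof.
move=> fi [u u1 Au]; have [g [gi fK gK]] := isometry_inverse fi.
exists (f (p + u) - f p); first by rewrite isometry_diff.
move=> d; pose d' := g (f p + d) - p.
have -> : d = f (p + d') - f p by rewrite /d' [p + _]addrC subrK gK [f p + d]addrC addrK.
rewrite !isometry_diff// => du dd; have [x x0 Ax] := Au _ du dd.
exists x => // e /Ax Ae; rewrite -isometry_line//.
by apply: isometry_interior => //; exists (p + e *: d').
Qed.

(** In particular a wide corner of A is adherent to the interior of A. *)
Lemma wide_corner_closure A p : wide_corner A p ->
  forall B, open B -> B p -> A° `&` B !=set0.
Proof.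
move=> [u u1 Au] B oB Bp; have [| |x x0 Ax] := Au u; rewrite ?u1//; first lra.
have cvgp : (fun e : R => p + e *: u) @ 0^'+ --> p.
  rewrite -[X in _ --> X]addr0 -(scale0r u).
  apply: cvgD; first exact: cvg_cst.
  by apply: cvgZr_tmp; apply: cvg_at_right_filter; exact: cvg_id.
have Bp' : nbhs p B by exact: open_nbhs_nbhs.
near (0 : R)^'+ => e; exists (p + e *: u); split; last by near: e; exact: cvgp.
by apply: Ax; apply/andP; split; near: e; [exact: nbhs_right_gt|exact: nbhs_right_lt].
Unshelve. all: by end_near. Qed.

End WideCorners.

(** * Regions enclosed by a compact set *)

Section EnclosedRegion.
Variable R : realType.
Implicit Types (p q a b : plane R) (A B U F : set (plane R)) (s : seq (plane R)).

Lemma bounded_setE A : bounded_set A <-> exists M : R, forall p, A p -> `|p| <= M.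
Proof.
split=> [[M [_ bA]]|[M bA]].
  by exists (M + 1) => p; apply: bA; rewrite ltrDl.
by exists M; split=> [|x Mx p Ap]; [exact: num_real|exact: le_trans (bA _ Ap) (ltW Mx)].
Qed.

Lemma segment_param_continuous a b :
  continuous (fun t : R => (1 - t) *: a + t *: b).
Proof.
move=> t; apply: cvgD; apply: cvgZr_tmp; last exact: cvg_id.
by apply: cvgB; [exact: cvg_cst|exact: cvg_id].
Qed.

Lemma segment_image_compact a b : compact (segment a b).
Proof.
apply: continuous_compact; last exact: segment_compact.
exact: continuous_subspaceT (@segment_param_continuous a b).
Qed.

Lemma segment_image_connected a b : connected (segment a b).
Proof.
apply: connected_continuous_connected; first exact: segment_connected.
exact: continuous_subspaceT (@segment_param_continuous a b).
Qed.

Lemma segmentl a b : segment a b a.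
Proof. by exists 0; rewrite ?subr0 ?scale1r ?scale0r ?addr0//= in_itv/= lexx ler01. Qed.

Lemma segmentr a b : segment a b b.
Proof. by exists 1; rewrite ?subrr ?scale1r ?scale0r ?add0r//= in_itv/= lexx ler01. Qed.

Lemma polyline1 a : polyline [:: a] = set0.
Proof. by apply/seteqP; split=> // p []. Qed.

Lemma polyline_cons a b s :
  polyline [:: a, b & s] = segment a b `|` polyline (b :: s).
Proof.
apply/seteqP; split=> p.
  by case=> [[|i]] /= si pi; [left|right; exists i].
by case=> [abp|[i /= si pi]]; [exists 0%N|exists i.+1].
Qed.

Lemma polyline_compact a s : compact (polyline (a :: s)).
Proof.
elim: s a => [|b s IHs] a; first by rewrite polyline1; exact: compact0.
by rewrite polyline_cons; apply: compactU; [exact: segment_image_compact|exact: IHs].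
Qed.

Lemma reflection_continuous a b : continuous (reflection a b).
Proof.
pose n := dotp (b - a) (b - a); pose v := b - a.
have -> : reflection a b = fun p => (a - (2 * dotp a v / n) *: v + a) +
    ((2 / n * v.1 * v.1 - 1) * p.1 + (2 / n * v.2 * v.1) * p.2,
     (2 / n * v.1 * v.2) * p.1 + (2 / n * v.2 * v.2 - 1) * p.2).
  apply/funext => p; rewrite /reflection -/v -/n /dotp.
  by apply: injective_projections; rewrite /= /GRing.scale/=; ring.
exact: linear_coords_continuous.
Qed.

(** The complement is open: a ball avoiding B lies in a single component of the
    complement of B. *)
Lemma enclosed_region_closed B : compact B -> closed (enclosed_region B).
Proof.
move=> cB; have clB : closed B by apply: compact_closed => //; exact: norm_hausdorff.
rewrite -[X in closed X]setCK; apply: open_closedC; rewrite openE => p /= Ep.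
have nBp : ~ B p by move=> Bp; apply: Ep; left.
have /nbhs_ballP[e e0 pB] : nbhs p (~` B).
  by apply: open_nbhs_nbhs; split=> //; exact: closed_openC.
apply/nbhs_ballP; exists e => // q pq [/(pB _ pq)//|[_ bq]]; apply: Ep; right.
split=> //; suff <- : connected_component (~` B) q = connected_component (~` B) p by [].
apply: same_connected_component; exists (segment p q); last exact: segmentl.
split; [exact: segmentr| |exact: segment_image_connected].
move=> _ [t /= + <-]; rewrite in_itv/= => /andP[t0 t1]; apply: pB.
move: pq; rewrite -!ball_normE /=; apply: le_lt_trans.
have -> : p - ((1 - t) *: p + t *: q) = t *: (p - q).
  by rewrite scalerBl scale1r scalerBr opprD opprB addrA addrCA subrr addr0.
by rewrite normrZ ger0_norm// ler_piMl.
Qed.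

(** Far from B, the half-line pointing away from the origin stays in the
    complement of B and is unbounded. *)
Lemma enclosed_region_bounded B : bounded_set B -> bounded_set (enclosed_region B).
Proof.
move=> /bounded_setE[M bB]; apply/bounded_setE; exists (Num.max M 0) => p.
case=> [/bB pM|[nBp /bounded_setE[N bC]]]; first by rewrite le_max pM.
rewrite leNgt gt_max; apply/negP => /andP[Mp p0].
pose ray := (fun t : R => t *: p) @` `[1, +oo[.
have rayC : ray `<=` connected_component (~` B) p.
  apply: connected_component_max.
  - by exists 1; rewrite ?scale1r//= in_itv/= lexx.
  - move=> _ [t /= + <-] /bB; rewrite in_itv/= andbT normrZ => t1; apply/negP.
    rewrite -ltNge (lt_le_trans Mp)// ler_peMl//.
    by rewrite ger0_norm// (le_trans ler01).
  - apply: connected_continuous_connected.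
      exact/connected_intervalP/interval_is_interval.
    by apply: continuous_subspaceT => t; apply: cvgZr_tmp; exact: cvg_id.
pose y := `|N| / `|p| + 1.
have y1 : 1 <= y by rewrite /y lerDr divr_ge0.
have /bC : connected_component (~` B) p (y *: p).
  by apply: rayC; exists y => //=; rewrite in_itv/= y1.
rewrite normrZ ger0_norm ?(le_trans ler01)// /y mulrDl mul1r divfK ?gt_eqF//.
by have := ler_norm N; lra.
Qed.

(** If the points of F outside the open set U lie on B, then U is closed in the
    complement of B, so that it contains the component of each of its points. *)
Lemma sub_enclosed_region B U F : open U -> closed F -> U `<=` F ->
  F `<=` U `|` B -> bounded_set U -> U `<=` enclosed_region B.
Proof.
move=> oU clF UF FUB bU p Up; have [Bp|nBp] := pselect (B p); [by left|right].
split=> //; set C := connected_component _ _.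
have CB : C `<=` ~` B by exact: connected_component_sub.
suff CU : C `<=` U.
  by move/bounded_setE : bU => [M bU]; apply/bounded_setE; exists M => x /CU /bU.
have <- : C `&` U = C; last by move=> x [].
apply: (@component_connected _ (~` B) p).
- by exists p; split=> //; exact: connected_component_refl.
- by exists U.
- exists F => //; apply/seteqP; split=> x [Cx]; first by move=> /UF.
  by move=> /FUB[//|Bx]; have := CB _ Cx.
Qed.

End EnclosedRegion.

(** * Coordinates for the regular heptagon *)

Section HeptagonCoordinates.
Variable R : realType.

(** c = cos (2 pi / 7) is the only positive root of 8 X^3 + 4 X^2 - 4 X - 1: the
    equation is cos (4 alpha) = cos (3 alpha) for alpha = 2 pi / 7, divided by
    c - 1. *)
Lemma cos_2pi7 : let c := cos (2 * pi / 7 : R) in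
  8 * c ^+ 3 + 4 * c ^+ 2 - 4 * c - 1 = 0 /\ 31 / 50 < c < 63 / 100.
Proof.
move=> c; pose a : R := 2 * pi / 7; have pi0 := pi_gt0 R.
have c0 : 0 < c by apply: cos_gt0_pihalf; rewrite -/a /a; lra.
have s0 : 0 < sin a by apply: sin_gt0_pi; rewrite /a; lra.
have sc : c ^+ 2 + sin a ^+ 2 = 1 by exact: cos2Dsin2.
have c1 : c < 1 by nra.
have e34 : cos (a + a + (a + a)) = cos (a + a + a).
  have -> : a + a + (a + a) = - (a + a + a) + 2 * pi by rewrite /a; field.
  by rewrite mulr_natl cosD2pi cosN.
have cE : 8 * c ^+ 3 + 4 * c ^+ 2 - 4 * c - 1 = 0.
  have : (c - 1) * (8 * c ^+ 3 + 4 * c ^+ 2 - 4 * c - 1) = 0.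
    have C2 : cos (a + a) = 2 * c ^+ 2 - 1.
      by rewrite cosD -/c; move: sc; lra.
    have S2 : sin (a + a) = 2 * sin a * c by rewrite sinD -/c; ring.
    have S3 : cos (a + a + a) = (2 * c ^+ 2 - 1) * c - 2 * sin a * c * sin a.
      by rewrite cosD C2 S2.
    move: e34; rewrite S3 cosD C2 S2 => e34.
    transitivity ((2 * c ^+ 2 - 1) * (2 * c ^+ 2 - 1) -
      2 * sin a * c * (2 * sin a * c) - ((2 * c ^+ 2 - 1) * c -
      2 * sin a * c * sin a) + (4 * c ^+ 2 - 2 * c) * (c ^+ 2 + sin a ^+ 2 - 1)).
      by ring.
    by rewrite e34 sc; ring.
  by move/eqP; rewrite mulf_eq0 subr_eq0 (lt_eqF c1) => /eqP.
split=> //; apply/andP; split; rewrite ltNge; apply/negP => ?; nra.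
Qed.

(** The point with coordinates (X, y) in the frame with origin o, first axis e,
    and second axis k times the image of e under the rotation by pi / 2. *)
Definition pt (o e : plane R) (k X y : R) : plane R :=
  (o.1 + X * e.1 - y * (k * e.2), o.2 + X * e.2 + y * (k * e.1)).

(** With o the centre, e = v_2 - o and k = sin (2 pi / 7) up to sign, the
    coordinates of all vertices are polynomials in c = cos (2 pi / 7). *)
Lemma heptagon_coords v : regular_heptagon v -> exists (o e : plane R) (c k : R),
  [/\ 0 < dotp e e, 8 * c ^+ 3 + 4 * c ^+ 2 - 4 * c - 1 = 0, 31 / 50 < c < 63 / 100,
   k ^+ 2 = 1 - c ^+ 2 & let P := pt o e k in
   [/\ v 0%N = P (2 * c ^+ 2 - 1) (- (2 * c)), v 1%N = P c (- 1), v 2%N = P 1 0,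
    v 3%N = P c 1 & [/\ v 4%N = P (2 * c ^+ 2 - 1) (2 * c),
     v 5%N = P (4 * c ^+ 3 - 3 * c) (4 * c ^+ 2 - 1) &
     v 6%N = P (4 * c ^+ 3 - 3 * c) (- (4 * c ^+ 2 - 1))]]].
Proof.
move=> [ o [r [theta [b [r0 vE]]]]]; have [cE cb] := cos_2pi7.
set a : R := 2 * pi / 7 in vE cE cb; set c := cos a in cE cb.
pose t : R := (-1) ^+ b; pose s := sin a; pose phi := theta + t * (2 * a).
have t2 : t ^+ 2 = 1 by rewrite /t sqrr_sign.
have ss : s ^+ 2 = 1 - c ^+ 2 by rewrite -(cos2Dsin2 a) -/c -/s; ring.
have tE x : cos (t * x) = cos x /\ sin (t * x) = t * sin x.
  by rewrite /t; case: b {vE t phi t2}; rewrite ?expr1 ?expr0 ?mulN1r ?mul1r ?cosN ?sinN.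
have vk (k : nat) x : (k < 7)%N -> k%:R * a = 2 * a + x ->
    v k = pt o (r * cos phi, r * sin phi) t (cos x) (sin x).
  move=> k7 kx; rewrite (vE _ k7) kx mulrDr addrA -/t -/phi.
  have [cx sx] := tE x; rewrite (cosD phi) (sinD phi) cx sx.
  by apply: injective_projections; rewrite /= /GRing.scale/=; ring.
have cs1 : cos (- a) = c /\ sin (- a) = - s by rewrite cosN sinN.
have cs2 : cos (a + a) = 2 * c ^+ 2 - 1 /\ sin (a + a) = s * (2 * c).
  rewrite cosD sinD -/c -/s; split; last by ring.
  by move: ss; lra.
have cs3 : cos (a + a + a) = 4 * c ^+ 3 - 3 * c /\ sin (a + a + a) = s * (4 * c ^+ 2 - 1).
  rewrite (cosD (a + a)) (sinD (a + a)) cs2.1 cs2.2 -/c -/s; split; last by ring.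
  transitivity ((2 * c ^+ 2 - 1) * c - 2 * c * s ^+ 2); first by ring.
  by rewrite ss; ring.
have cs4 : cos (2 * pi - (a + a + a)) = 4 * c ^+ 3 - 3 * c /\
    sin (2 * pi - (a + a + a)) = - (s * (4 * c ^+ 2 - 1)).
  by rewrite cosB sinB [2 * pi]mulr_natl cos2pi sin2pi cs3.1 cs3.2; split; ring.
exists o, (r * cos phi, r * sin phi), c, (t * s); split=> //.
- have -> : dotp (r * cos phi, r * sin phi) (r * cos phi, r * sin phi) =
    r ^+ 2 * (cos phi ^+ 2 + sin phi ^+ 2) by rewrite /dotp /=; ring.
  by rewrite cos2Dsin2 mulr1 exprn_gt0.
- by rewrite exprMn t2 ss mul1r.
have ptE X y : pt o (r * cos phi, r * sin phi) (t * s) X y =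
    pt o (r * cos phi, r * sin phi) t X (s * y).
  by rewrite /pt; congr (_, _) => /=; ring.
move=> P; rewrite /P !ptE; split; last split.
- rewrite (vk _ (- (a + a))) ?cosN ?sinN ?cs2.1 ?cs2.2//; last by rewrite /a; ring.
  by congr (pt _ _ _ _ _); ring.
- rewrite (vk _ (- a)) ?cs1.1 ?cs1.2//; last by rewrite /a; ring.
  by congr (pt _ _ _ _ _); ring.
- by rewrite (vk _ 0) ?cos0 ?sin0 ?mulr0//; rewrite /a; ring.
- by rewrite (vk _ a) ?mulr1//; ring.
- rewrite (vk _ (a + a)) ?cs2.1 ?cs2.2//; last by rewrite /a; ring.
- by rewrite (vk _ (a + a + a)) ?cs3.1 ?cs3.2//; rewrite /a; ring.
- by rewrite (vk _ (2 * pi - (a + a + a))) ?cs4.1 ?cs4.2 ?mulrN//; rewrite /a; field.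
Qed.

End HeptagonCoordinates.

(** * The prototile in coordinates *)

Section PrototileCoordinates.
Variables (R : realType) (o e : plane R) (c k : R) (v : nat -> plane R).
Hypotheses (e0 : 0 < dotp e e)
  (cE : 8 * c ^+ 3 + 4 * c ^+ 2 - 4 * c - 1 = 0) (cb : 31 / 50 < c < 63 / 100)
  (kk : k ^+ 2 = 1 - c ^+ 2).
Let P := pt o e k.
Hypotheses (v0 : v 0%N = P (2 * c ^+ 2 - 1) (- (2 * c))) (v1 : v 1%N = P c (- 1))
  (v2 : v 2%N = P 1 0) (v3 : v 3%N = P c 1) (v4 : v 4%N = P (2 * c ^+ 2 - 1) (2 * c))
  (v5 : v 5%N = P (4 * c ^+ 3 - 3 * c) (4 * c ^+ 2 - 1))
  (v6 : v 6%N = P (4 * c ^+ 3 - 3 * c) (- (4 * c ^+ 2 - 1))).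
Implicit Types (p d : plane R) (X y t : R).

(** The two concave vertices have coordinates (x5, y5) and (x5, - y5). *)
Let x5 := 2 * (2 * c ^+ 2 - 1) - (4 * c ^+ 3 - 3 * c).
Let y5 := 4 * c ^+ 2 - 1.

Let clo : 31 / 50 < c. Proof. by case/andP: cb. Qed.
Let chi : c < 63 / 100. Proof. by case/andP: cb. Qed.
Let c2lo : 961 / 2500 < c ^+ 2. Proof. by move: clo chi; nra. Qed.
Let c2hi : c ^+ 2 < 3969 / 10000. Proof. by move: clo chi; nra. Qed.

Let x5E : x5 = 6 * c ^+ 2 + c - 5 / 2.
Proof. by rewrite /x5; move: cE; lra. Qed.

(** The concave edges through v_0 and v_4 point towards v_2. *)
Let x5_line : c * x5 + (1 - c ^+ 2) * y5 = c.
Proof.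
transitivity (c - (c - 1) * (8 * c ^+ 3 + 4 * c ^+ 2 - 4 * c - 1)).
  by rewrite /x5 /y5; ring.
by rewrite cE; ring.
Qed.

Let k0 : k != 0.
Proof. by apply: contraTneq c2hi => k_eq0; rewrite -leNgt; move: kk; rewrite k_eq0; lra. Qed.

Let xcoord p := dotp (p - o) e / dotp e e.
Let ycoord p := ((p.2 - o.2) * e.1 - (p.1 - o.1) * e.2) / (k * dotp e e).

Let coordsK p : P (xcoord p) (ycoord p) = p.
Proof.
have n0 := lt0r_neq0 e0; rewrite /P /pt /xcoord /ycoord; move: n0; rewrite /dotp => n0.
by apply: injective_projections => /=; field; rewrite n0 k0.
Qed.

Let xcoord_pt X y : xcoord (P X y) = X.
Proof.
have n0 := lt0r_neq0 e0; rewrite /P /pt /xcoord; move: n0; rewrite /dotp => n0 /=.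
by field; rewrite n0.
Qed.

Let ycoord_pt X y : ycoord (P X y) = y.
Proof.
have n0 := lt0r_neq0 e0; rewrite /P /pt /ycoord; move: n0; rewrite /dotp => n0 /=.
by field; rewrite n0 k0.
Qed.

Let segment_pt t X y X' y' : 0 <= t <= 1 ->
  segment (P X y) (P X' y') (P ((1 - t) * X + t * X') ((1 - t) * y + t * y')).
Proof.
move=> t01; exists t => //.
by apply: injective_projections; rewrite /= /GRing.scale/=; ring.
Qed.

Let reflection_pt X y :
  reflection (v 0%N) (v 4%N) (P X y) = P (2 * (2 * c ^+ 2 - 1) - X) y.
Proof.
have n0 := lt0r_neq0 e0; have c0 : c != 0 by rewrite gt_eqF//; move: clo; lra.
set m := 2 * c ^+ 2 - 1.
have bE : v 4%N - v 0%N = (4 * c) *: (- (k * e.2), k * e.1).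
  rewrite v0 v4 /P /pt -/m; apply: injective_projections; rewrite /= /GRing.scale/=; ring.
have pE : P X y - v 0%N = ((X - m) * e.1 - (y + 2 * c) * (k * e.2),
    (X - m) * e.2 + (y + 2 * c) * (k * e.1)).
  by rewrite v0 /P /pt -/m; apply: injective_projections => /=; ring.
rewrite /reflection bE pE v0 /P /pt -/m; move: n0; rewrite /dotp /= => n0.
have side : 4 * c * - (k * e.2) * (4 * c * - (k * e.2)) +
    4 * c * (k * e.1) * (4 * c * (k * e.1)) != 0.
  have -> : 4 * c * - (k * e.2) * (4 * c * - (k * e.2)) +
    4 * c * (k * e.1) * (4 * c * (k * e.1)) =
    (4 * c * k) ^+ 2 * (e.1 * e.1 + e.2 * e.2) by ring.
  by rewrite mulf_neq0// expf_neq0// !mulf_neq0// pnatr_eq0.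
by apply: injective_projections; rewrite /= /GRing.scale/=; field.
Qed.

Let boundary_edge i p : (i < 4)%N -> segment (v i) (v i.+1) p -> prototile_boundary v p.
Proof.
move=> i4 vp; left; exists i; first by rewrite /= ltnS ltnS.
by move: i i4 vp => [|[|[|[|]]]].
Qed.

Let reflected_edge i X y t X' y' X'' y'' : (i < 3)%N -> 0 <= t <= 1 ->
  [:: v 4%N; v 5%N; v 6%N; v 0%N]`_i = P X y ->
  [:: v 4%N; v 5%N; v 6%N; v 0%N]`_i.+1 = P X' y' ->
  X'' = 2 * (2 * c ^+ 2 - 1) - ((1 - t) * X + t * X') ->
  y'' = (1 - t) * y + t * y' ->
  prototile_boundary v (P X'' y'').
Proof.
move=> i3 t01 vi vi1 -> ->; right; exists (P ((1 - t) * X + t * X') ((1 - t) * y + t * y')).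
  by exists i; [rewrite /= !ltnS|rewrite vi vi1; exact: segment_pt].
by rewrite reflection_pt.
Qed.

Let straight_edge i X y t X' y' X'' y'' : (i < 4)%N -> 0 <= t <= 1 ->
  v i = P X y -> v i.+1 = P X' y' ->
  X'' = (1 - t) * X + t * X' -> y'' = (1 - t) * y + t * y' ->
  prototile_boundary v (P X'' y'').
Proof.
by move=> i4 t01 vi vi1 -> ->; apply: (boundary_edge i4); rewrite vi vi1; exact: segment_pt.
Qed.

(** The open polygon enclosed by the boundary of the prototile. As y |-> - y is its
    symmetry, it is given by conditions on X and |y|: X is below the lines through
    two convex edges, and above the line through one of two concave edges. *)
Let inner p := let X := xcoord p in let y := `|ycoord p| in
  [/\ X + (1 - c) * y < 1, (2 * c - 1) * (X - c) + (1 - c) * (1 + 2 * c) * (y - 1) < 0 &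
    x5 < X \/ c < c * X + (1 - c ^+ 2) * y].

(** The closed counterpart: its points not in inner are on the boundary. *)
Let outer p := let X := xcoord p in let y := `|ycoord p| in
  [/\ X + (1 - c) * y <= 1, (2 * c - 1) * (X - c) + (1 - c) * (1 + 2 * c) * (y - 1) <= 0 &
    x5 <= X \/ c <= c * X + (1 - c ^+ 2) * y].

(** The edges at v_2. *)
Let convex_edge1 X y : X + (1 - c) * `|y| = 1 -> `|y| <= 1 ->
  prototile_boundary v (P X y).
Proof.
have [y0|y0] := ger0P y => XE y1.
- by apply: (@straight_edge 2 1 0 y c 1) => //; [apply/andP; split| |]; lra.
- by apply: (@straight_edge 1 c (- 1) (1 + y) 1 0) => //; [apply/andP; split| |]; lra.
Qed.

(** The edges v_0 v_1 and v_3 v_4. *)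
Let convex_edge2 X y : (2 * c - 1) * (X - c) + (1 - c) * (1 + 2 * c) * (`|y| - 1) = 0 ->
  1 <= `|y| <= 2 * c -> prototile_boundary v (P X y).
Proof.
have d0 : 0 < 2 * c - 1 by move: clo; lra.
move=> XE /andP[y1 y2c]; pose t := (`|y| - 1) / (2 * c - 1).
have t01 : 0 <= t <= 1.
  by rewrite /t divr_ge0 ?ler_pdivrMr //=; lra.
have tE : `|y| = 1 + t * (2 * c - 1) by rewrite /t divfK ?gt_eqF//; lra.
have XtE : X = (1 - t) * c + t * (2 * c ^+ 2 - 1).
  apply/eqP; rewrite -subr_eq0; apply/eqP.
  apply: (@mulfI _ (2 * c - 1)); first by rewrite gt_eqF.
  by rewrite mulr0 -XE tE; ring.
case/andP: t01 => t0 t1; move: tE; have [y0|y0] := ger0P y => tE.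
- by apply: (@straight_edge 3 c 1 t (2 * c ^+ 2 - 1) (2 * c)) => //;
    [apply/andP; split| ]; lra.
- apply: (@straight_edge 0 (2 * c ^+ 2 - 1) (- (2 * c)) (1 - t) c (- 1)) => //;
    [apply/andP; split| |]; lra.
Qed.

(** The edge between the two concave vertices. *)
Let concave_edge1 y : `|y| <= y5 -> prototile_boundary v (P x5 y).
Proof.
move=> yy; have y50 : 0 < y5 by rewrite /y5; move: c2lo; lra.
have tE : y5 * 2 * ((y5 - y) / (y5 * 2)) = y5 - y by rewrite mulrC divfK ?gt_eqF//; lra.
have t01 : 0 <= (y5 - y) / (y5 * 2) <= 1.
  by move: yy; rewrite ler_norml => /andP[y0 y1]; rewrite divr_ge0 ?ler_pdivrMr //=; lra.
apply: (@reflected_edge 1 (4 * c ^+ 3 - 3 * c) y5 _ (4 * c ^+ 3 - 3 * c) (- y5) _ _ _ t01) => //.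
- by rewrite /x5; ring.
- by move: tE; set t := _ / _; lra.
Qed.

(** The concave edges at v_0 and v_4. *)
Let concave_edge2 X y : c * X + (1 - c ^+ 2) * `|y| = c -> y5 <= `|y| <= 2 * c ->
  prototile_boundary v (P X y).
Proof.
have c0 : 0 < c by move: clo; lra.
have d0 : 0 < 2 * c - y5 by rewrite /y5; move: clo c2hi; lra.
move=> XE /andP[y1 y2c]; pose t := (2 * c - `|y|) / (2 * c - y5).
have t01 : 0 <= t <= 1.
  by rewrite /t divr_ge0 ?ler_pdivrMr //=; lra.
have tE : `|y| = 2 * c - t * (2 * c - y5) by rewrite /t divfK ?gt_eqF//; lra.
have XtE : X = 2 * (2 * c ^+ 2 - 1) -
    ((1 - t) * (2 * c ^+ 2 - 1) + t * (4 * c ^+ 3 - 3 * c)).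
  apply/eqP; rewrite -subr_eq0; apply/eqP; apply: (mulfI (lt0r_neq0 c0)); rewrite mulr0.
  transitivity (c * X + (1 - c ^+ 2) * `|y| - c -
      t * (c * x5 + (1 - c ^+ 2) * y5 - c)); first by rewrite tE /x5; ring.
  by rewrite XE x5_line; ring.
case/andP: t01 => t0 t1; move: tE; have [y0|y0] := ger0P y => tE.
- apply: (@reflected_edge 0 (2 * c ^+ 2 - 1) (2 * c) t (4 * c ^+ 3 - 3 * c) y5) => //.
    by rewrite t0.
  by lra.
- apply: (@reflected_edge 2 (4 * c ^+ 3 - 3 * c) (- y5) (1 - t) (2 * c ^+ 2 - 1) (- (2 * c))) => //.
  + by apply/andP; split; lra.
  + by rewrite XtE; ring.
  + by lra.
Qed.

Let outer_sub : outer `<=` inner `|` prototile_boundary v.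
Proof.
move=> p op; suff : inner p \/ prototile_boundary v (P (xcoord p) (ycoord p)).
  by rewrite coordsK.
move: op; rewrite /outer /inner /=; move: (xcoord p) (ycoord p) => X y.
set Y := `|y| => -[h1 h2 h3]; have Y0 : 0 <= Y by exact: normr_ge0.
have c1 : 0 < 1 - c by move: chi; lra.
have d1 : 0 < 2 * c - 1 by move: clo; lra.
have [e1|n1] := eqVneq (X + (1 - c) * Y) 1.
  right; apply: convex_edge1 => //; rewrite -/Y.
  have : (1 - c) * (Y - 1) <= 0; last by rewrite pmulr_rle0//; lra.
  move: h2; have -> : X = 1 - (1 - c) * Y by lra.
  by lra.
have [e2|n2] := eqVneq ((2 * c - 1) * (X - c) + (1 - c) * (1 + 2 * c) * (Y - 1)) 0.
  right; apply: convex_edge2 => //; rewrite -/Y.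
  have XE : (2 * c - 1) * X = (2 * c - 1) * c - (1 - c) * (1 + 2 * c) * (Y - 1) by lra.
  have : 0 <= (1 - c) * (Y - 1).
    have : (2 * c - 1) * (X + (1 - c) * Y) <= (2 * c - 1) * 1 by rewrite ler_wpM2l// ltW.
    rewrite mulrDr XE; lra.
  rewrite pmulr_rge0// => Y1; apply/andP; split; first lra.
  case: h3 => h3.
    have : (2 * c - 1) * x5 <= (2 * c - 1) * X by rewrite ler_wpM2l// ltW.
    rewrite XE => h; rewrite leNgt; apply/negP => Y2c.
    have B0 : 4 / 5 < (1 - c) * (1 + 2 * c) by move: clo c2hi; lra.
    have : 4 / 5 * (Y - 1) < (1 - c) * (1 + 2 * c) * (Y - 1).
      by rewrite ltr_pM2r//; move: clo; lra.
    have : (2 * c - 1) * (c - x5) <= (2 * c - 1) * (1 / 5).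
      by rewrite ler_pM2l// x5E; move: c2lo; lra.
    by move: clo chi; lra.
  have : (2 * c - 1) * c <= (2 * c - 1) * (c * X + (1 - c ^+ 2) * Y) by rewrite ler_wpM2l// ltW.
  have -> : (2 * c - 1) * (c * X + (1 - c ^+ 2) * Y) =
    c * ((2 * c - 1) * X) + (2 * c - 1) * (1 - c ^+ 2) * Y by ring.
  rewrite XE => h.
  have : 0 <= (1 - c) * (2 * c - Y) by lra.
  by rewrite pmulr_rge0//; lra.
have {}h1 : X + (1 - c) * Y < 1 by rewrite lt_neqAle n1.
have {}h2 : (2 * c - 1) * (X - c) + (1 - c) * (1 + 2 * c) * (Y - 1) < 0 by rewrite lt_neqAle n2.
have [h4|h4] := ltP x5 X; first by left; split=> //; left.
have [h5|h5] := ltP c (c * X + (1 - c ^+ 2) * Y); first by left; split=> //; right.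
right; case: h3 => h3.
  have e3 : X = x5 by apply/eqP; rewrite eq_le h4.
  rewrite e3; apply: concave_edge1; rewrite -/Y.
  have : (1 - c ^+ 2) * Y <= (1 - c ^+ 2) * y5 by move: h5 x5_line; rewrite e3; lra.
  by rewrite ler_pM2l//; move: c2hi; lra.
have e3 : c * X + (1 - c ^+ 2) * Y = c by apply/eqP; rewrite eq_le h5.
apply: concave_edge2 => //; rewrite -/Y; apply/andP; split.
  have : (1 - c ^+ 2) * y5 <= (1 - c ^+ 2) * Y.
    have : c * X <= c * x5 by rewrite ler_wpM2l//; move: clo; lra.
    by move: x5_line e3; lra.
  by rewrite ler_pM2l//; move: c2hi; lra.
have : c * ((2 * c - 1) * (X - c) + (1 - c) * (1 + 2 * c) * (Y - 1)) <= 0.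
  by rewrite pmulr_rle0 ?ltW//; move: clo; lra.
have -> : c * ((2 * c - 1) * (X - c) + (1 - c) * (1 + 2 * c) * (Y - 1)) =
  (2 * c - 1) * (c * X) - (2 * c - 1) * c ^+ 2 + c * (1 - c) * (1 + 2 * c) * (Y - 1) by ring.
have -> : c * X = c - (1 - c ^+ 2) * Y by lra.
move=> h; have : (1 - c) * (Y - 2 * c) <= 0 by lra.
by rewrite pmulr_rle0//; lra.
Qed.

Let coord_continuous (x y : R) : continuous (fun p => x * xcoord p + y * `|ycoord p|).
Proof.
have lin (w z : R) q : continuous (fun p : plane R => (q + (w * p.1 + z * p.2, 0 * p.1 + 0 * p.2)).1).
  move=> p; apply: (continuous_comp (@linear_coords_continuous _ w z 0 0 q p)).
  exact: cvg_fst.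
have cx : continuous xcoord.
  pose n := dotp e e.
  have -> : xcoord = fun p => ((- (o.1 * e.1 + o.2 * e.2) / n, 0) +
      (e.1 / n * p.1 + e.2 / n * p.2, 0 * p.1 + 0 * p.2)).1.
    by apply/funext => p; rewrite /xcoord -/n /dotp /=; ring.
  exact: lin.
have cy : continuous ycoord.
  pose n := k * dotp e e.
  have -> : ycoord = fun p => (((o.1 * e.2 - o.2 * e.1) / n, 0) +
      (- e.2 / n * p.1 + e.1 / n * p.2, 0 * p.1 + 0 * p.2)).1.
    by apply/funext => p; rewrite /ycoord -/n /=; ring.
  exact: lin.
move=> p; apply: cvgD; apply: cvgM; first [exact: cvg_cst | exact: cx | idtac].
by apply: cvg_norm; exact: cy.
Qed.

Let inner_open : open inner.
Proof.
have lt_open (x y z : R) : open [set p | x * xcoord p + y * `|ycoord p| < z].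
  by move/continuousP: (@coord_continuous x y) => /(_ _ (@open_lt _ z)).
have gt_open (x y z : R) : open [set p | z < x * xcoord p + y * `|ycoord p|].
  by move/continuousP: (@coord_continuous x y) => /(_ _ (@open_gt _ z)).
have -> : inner = [set p | 1 * xcoord p + (1 - c) * `|ycoord p| < 1] `&`
   ([set p | (2 * c - 1) * xcoord p + (1 - c) * (1 + 2 * c) * `|ycoord p| <
      (2 * c - 1) * c + (1 - c) * (1 + 2 * c)] `&`
   ([set p | x5 < 1 * xcoord p + 0 * `|ycoord p|] `|`
    [set p | c < c * xcoord p + (1 - c ^+ 2) * `|ycoord p|])).
  apply/seteqP; split=> p; rewrite /inner /= !mul1r mul0r addr0.
    by move=> [h1 h2 h3]; split=> //; split=> //; lra.
  by move=> [h1 [h2 h3]]; split=> //; lra.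
by do !apply: openI => //; exact: openU.
Qed.

Let outer_closed : closed outer.
Proof.
have le_closed (x y z : R) : closed [set p | x * xcoord p + y * `|ycoord p| <= z].
  by move/continuous_closedP: (@coord_continuous x y) => /(_ _ (@closed_le _ z)).
have ge_closed (x y z : R) : closed [set p | z <= x * xcoord p + y * `|ycoord p|].
  by move/continuous_closedP: (@coord_continuous x y) => /(_ _ (@closed_ge _ z)).
have -> : outer = [set p | 1 * xcoord p + (1 - c) * `|ycoord p| <= 1] `&`
   ([set p | (2 * c - 1) * xcoord p + (1 - c) * (1 + 2 * c) * `|ycoord p| <=
      (2 * c - 1) * c + (1 - c) * (1 + 2 * c)] `&`
   ([set p | x5 <= 1 * xcoord p + 0 * `|ycoord p|] `|`
    [set p | c <= c * xcoord p + (1 - c ^+ 2) * `|ycoord p|])).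
  apply/seteqP; split=> p; rewrite /outer /= !mul1r mul0r addr0.
    by move=> [h1 h2 h3]; split=> //; split=> //; lra.
  by move=> [h1 [h2 h3]]; split=> //; lra.
by do !apply: closedI => //; exact: closedU.
Qed.

Let inner_bounded : bounded_set inner.
Proof.
apply/bounded_setE; exists (`|o| + 1 * `|e| + 3 * `|(- (k * e.2), k * e.1) : plane R|) => p.
rewrite /inner /=; set X := xcoord p; set y := ycoord p; set Y := `|y|.
have Y0 : 0 <= Y by exact: normr_ge0.
move=> [h1 h2 h3].
have c1 : 0 < 1 - c by move: chi; lra.
have [Y3 X1] : Y <= 3 /\ - 1 <= X.
  case: h3 => h3.
    have X0 : 0 < X by move: h3; rewrite x5E; move: clo c2lo; lra.
    split; last lra.
    have : (1 - c) * Y <= (1 - c) * 3 by move: chi; lra.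
    by rewrite ler_pM2l.
  have : (2 * c - 1) * c < (2 * c - 1) * (c * X + (1 - c ^+ 2) * Y).
    by rewrite ltr_pM2l//; move: clo; lra.
  have : c * ((2 * c - 1) * (X - c) + (1 - c) * (1 + 2 * c) * (Y - 1)) < 0.
    by rewrite pmulr_rlt0//; move: clo; lra.
  move=> h4 h5; have : (1 - c) * (Y - 2 * c) <= 0 by lra.
  rewrite pmulr_rle0// => Y2c; split; first by move: chi; lra.
  have : c * (-1) <= c * X; last by rewrite ler_pM2l//; move: clo; lra.
  have : (1 - c ^+ 2) * Y <= (1 - c ^+ 2) * (2 * c) by rewrite ler_wpM2l//; move: c2hi; lra.
  have : 0 <= c * c ^+ 2 by rewrite mulr_ge0 ?sqr_ge0//; move: clo; lra.
  by move: h3; lra.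
rewrite -(coordsK p) -/X -/y.
have -> : P X y = o + X *: e + y *: ((- (k * e.2), k * e.1) : plane R).
  by apply: injective_projections; rewrite /= /GRing.scale/=; ring.
apply: le_trans (ler_normD _ _) _; rewrite normrZ lerD//; last by rewrite ler_wpM2r.
apply: le_trans (ler_normD _ _) _; rewrite normrZ lerD// ler_wpM2r//.
rewrite ler_norml X1 /=.
have : 0 <= (1 - c) * Y by rewrite mulr_ge0// ltW.
by lra.
Qed.

Let inner_sub : inner `<=` (prototile v)°.
Proof.
rewrite -open_subsetE; last exact: inner_open.
apply: sub_enclosed_region inner_open outer_closed _ outer_sub inner_bounded.
move=> p; rewrite /inner /outer /= => -[h1 h2 h3]; split; [exact: ltW|exact: ltW|].
by case: h3 => /ltW; [left|right].
Qed.

Let xcoord_line p d (t : R) : xcoord (p + t *: d) = xcoord p + t * xcoord (o + d).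
Proof. by rewrite /xcoord /dotp /= /GRing.scale/=; ring. Qed.

Let ycoord_line p d (t : R) : ycoord (p + t *: d) = ycoord p + t * ycoord (o + d).
Proof. by rewrite /ycoord /dotp /= /GRing.scale/=; ring. Qed.

Let small_steps (x y : R) : exists2 delta : R, 0 < delta &
  forall t, 0 < t < delta -> `|t * x| < 1 / 100 /\ `|t * y| < 1 / 100.
Proof.
have n0 : 0 < 1 + `|x| + `|y| by have := normr_ge0 x; have := normr_ge0 y; lra.
exists (1 / 100 / (1 + `|x| + `|y|)); first by rewrite divr_gt0.
move=> t /andP[t0]; rewrite ltr_pdivlMr// => td; rewrite !normrM (gtr0_norm t0).
have := mulr_ge0 (ltW t0) (normr_ge0 x); have := mulr_ge0 (ltW t0) (normr_ge0 y).
by split; lra.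
Qed.

(** With a the coordinate along the axis of a convex vertex and b the transversal
    one, divided by k, the conclusion describes the inner angle 5 pi / 7 and the
    hypothesis the sector of angle 2 pi / 3, which is smaller as c > 1 / 2. *)
Let narrow (a b : R) : 0 < a -> (1 - c ^+ 2) * b ^+ 2 <= 3 * a ^+ 2 ->
  - a < (1 - c) * b < a.
Proof.
move=> a0 ab; have c1 : 0 < 1 - c by move: chi; lra.
have : (1 + c) * ((1 - c) * b) ^+ 2 < (1 + c) * a ^+ 2.
  have -> : (1 + c) * ((1 - c) * b) ^+ 2 = (1 - c) * ((1 - c ^+ 2) * b ^+ 2) by ring.
  have : (1 - c) * ((1 - c ^+ 2) * b ^+ 2) <= (1 - c) * (3 * a ^+ 2) by rewrite ler_pM2l.
  have : 0 < (4 * c - 2) * a ^+ 2 by rewrite mulr_gt0 ?exprn_gt0//; move: clo; lra.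
  by lra.
rewrite ltr_pM2l; last by move: clo; lra.
by move=> h; apply/andP; split; nra.
Qed.

Let dotp_coords d : dotp d d = dotp e e * (xcoord (o + d) ^+ 2 +
  (1 - c ^+ 2) * ycoord (o + d) ^+ 2).
Proof.
rewrite -kk /xcoord /ycoord; have n0 := lt0r_neq0 e0; move: n0; rewrite /dotp /= => n0.
by field; rewrite n0 k0.
Qed.

Let dotp_axis d X y : dotp d (P X y - o) = dotp e e * (xcoord (o + d) * X +
  (1 - c ^+ 2) * ycoord (o + d) * y).
Proof.
rewrite -kk /xcoord /ycoord; have n0 := lt0r_neq0 e0; move: n0; rewrite /dotp /= => n0.
by field; rewrite n0 k0.
Qed.

(** To find a wide corner in coordinates, with axis the direction (X, y): there
    dotp d d and dotp d (P X y - o) are, up to the factor dotp e e, the quadratic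
    form x ^+ 2 + (1 - c ^+ 2) * z ^+ 2 and its polar form. *)
Let wide_corner_axis A p X y : X ^+ 2 + (1 - c ^+ 2) * y ^+ 2 = 1 ->
  (forall d, let x := xcoord (o + d) in let z := ycoord (o + d) in
    let w := x * X + (1 - c ^+ 2) * z * y in
    0 < w -> x ^+ 2 + (1 - c ^+ 2) * z ^+ 2 <= 4 * w ^+ 2 ->
    exists2 delta : R, 0 < delta & forall t, 0 < t < delta -> A° (p + t *: d)) ->
  wide_corner A p.
Proof.
move=> Xy1 Ap; pose n := Num.sqrt (dotp e e); have n0 : 0 < n by rewrite sqrtr_gt0.
have nn : n ^+ 2 = dotp e e by rewrite sqr_sqrtr// ltW.
have axis d : dotp d (n^-1 *: (P X y - o)) = n * (xcoord (o + d) * X +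
    (1 - c ^+ 2) * ycoord (o + d) * y).
  transitivity (n^-1 * dotp d (P X y - o)).
    by rewrite /dotp /= /GRing.scale/=; ring.
  by rewrite dotp_axis -nn; field; rewrite gt_eqF.
exists (n^-1 *: (P X y - o)).
  rewrite axis; set d := n^-1 *: _.
  have -> : xcoord (o + d) = n^-1 * X.
    by rewrite /d xcoord_line (addrC o) subrK xcoord_pt /xcoord subrr /dotp /=; ring.
  have -> : ycoord (o + d) = n^-1 * y.
    by rewrite /d ycoord_line (addrC o) subrK ycoord_pt /ycoord !subrr; ring.
  by rewrite -[RHS]Xy1; field; rewrite gt_eqF.
move=> d; rewrite axis dotp_coords pmulr_rgt0// => w0 dd; apply: Ap => //.
by move: dd; rewrite [(n * _) ^+ 2]exprMn nn [4 * _]mulrCA ler_pM2l.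
Qed.

(** The axis at v_1 and v_3 points to the centre of the heptagon. *)
Let wide_corner1 (tau : R) : tau = 1 \/ tau = - 1 -> wide_corner (prototile v) (P c tau).
Proof.
move=> tau1; apply: (@wide_corner_axis _ _ (- c) (- tau)).
  by case: tau1 => ->; ring.
move=> d x z w w0 dd; have [delta delta0 small] := small_steps x z.
exists delta => // t tdelta; have [tx tz] := small t tdelta; apply: inner_sub.
have t0 : 0 < t by case/andP: tdelta.
rewrite /inner /= xcoord_line ycoord_line xcoord_pt ycoord_pt -/x -/z.
pose z' := tau * z; have zz : z' ^+ 2 = z ^+ 2 by case: tau1 => tauE; rewrite /z' tauE; ring.
have tz' : `|t * z'| < 1 / 100.
  by rewrite /z'; case: tau1 => ->; [rewrite (mul1r z)|rewrite (mulN1r z) mulrN normrN].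
have -> : `|tau + t * z| = 1 + t * z'.
  move: tz'; rewrite /z' ltr_norml; case: tau1 => -> /andP[lo hi].
    by rewrite (mul1r z) ger0_norm//; lra.
  by rewrite ler0_norm//; lra.
have wE : w = - (c * x + (1 - c ^+ 2) * z') by rewrite /w /z'; ring.
have /andP[b1 b2] : - w < (1 - c) * (x - c * z') < w.
  apply: narrow => //.
  have : w ^+ 2 + (1 - c ^+ 2) * (x - c * z') ^+ 2 = x ^+ 2 + (1 - c ^+ 2) * z ^+ 2.
    by rewrite -zz wE; ring.
  by lra.
have step1 : t * (x + (1 - c) * z') < 0.
  by rewrite pmulr_rlt0//; move: b2; rewrite wE; lra.
have step2 : t * ((2 * c - 1) * x + (1 - c) * (1 + 2 * c) * z') < 0.
  by rewrite pmulr_rlt0//; move: b1; rewrite wE; lra.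
move: tx; rewrite ltr_norml => /andP[xlo xhi]; split; [lra|lra|left].
by rewrite x5E; move: clo c2hi; lra.
Qed.

Let wide_corner2 : wide_corner (prototile v) (P 1 0).
Proof.
apply: (@wide_corner_axis _ _ (- 1) 0); first by ring.
move=> d x z w w0 dd; have [delta delta0 small] := small_steps x z.
exists delta => // t tdelta; have [tx tz] := small t tdelta; apply: inner_sub.
have t0 : 0 < t by case/andP: tdelta.
rewrite /inner /= xcoord_line ycoord_line xcoord_pt ycoord_pt -/x -/z add0r.
have wE : w = - x by rewrite /w; ring.
have /andP[b1 b2] : - w < (1 - c) * `|z| < w.
  apply: narrow => //.
  by move: dd; rewrite wE sqrrN real_normK ?num_real//; lra.
have step1 : t * (x + (1 - c) * `|z|) < 0 by rewrite pmulr_rlt0//; move: b2; rewrite wE; lra.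
move: tx; rewrite ltr_norml => /andP[xlo xhi].
have x0 : t * x < 0 by rewrite pmulr_rlt0//; move: w0; rewrite wE; lra.
have tzE : `|t * z| = t * `|z| by rewrite normrM gtr0_norm.
split; first by rewrite tzE; lra.
  have : (2 * c - 1) * (t * x) < 0 by rewrite pmulr_rlt0//; move: clo; lra.
  have : (1 - c) * (1 + 2 * c) * `|t * z| <= (1 - c) * (1 + 2 * c) * (1 / 100).
    rewrite ler_wpM2l//; last exact: ltW.
    by rewrite mulr_ge0//; move: clo chi; lra.
  by move: clo chi c2lo; lra.
by left; rewrite x5E; move: clo chi c2hi; lra.
Qed.

(** At a concave vertex all directions with a positive first coordinate point
    inside. *)
Let wide_corner5 y : `|y| = y5 -> wide_corner (prototile v) (P x5 y).
Proof.
move=> yE; apply: (@wide_corner_axis _ _ 1 0); first by ring.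
move=> d x z w w0 dd; have [delta delta0 small] := small_steps x z.
exists delta => // t tdelta; have [tx tz] := small t tdelta; apply: inner_sub.
have t0 : 0 < t by case/andP: tdelta.
rewrite /inner /= xcoord_line ycoord_line xcoord_pt ycoord_pt -/x -/z.
have wE : w = x by rewrite /w; ring.
move: tx; rewrite ltr_norml => /andP[xlo xhi].
have x0 : 0 < t * x by rewrite mulr_gt0// -wE.
have yz : `|y + t * z| < y5 + 1 / 100 by rewrite (le_lt_trans (ler_normD _ _))// yE ltrD2l.
have c1 : 0 < 1 - c by move: chi; lra.
split; last by left; lra.
  have : (1 - c) * `|y + t * z| < (1 - c) * (y5 + 1 / 100) by rewrite ltr_pM2l.
  have : (1 - c) * (y5 + 1 / 100) <= (1 - c) * (6 / 10).
    by rewrite ler_wpM2l ?ltW// /y5; move: c2hi; lra.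
  by rewrite x5E; move: clo chi c2hi; lra.
have : (2 * c - 1) * (x5 + t * x - c) < 0.
  rewrite pmulr_rlt0; first by rewrite x5E; move: clo chi c2hi; lra.
  by move: clo; lra.
have : (1 - c) * (1 + 2 * c) * (`|y + t * z| - 1) < 0.
  rewrite pmulr_rlt0; first by move: yz; rewrite /y5; move: c2hi; lra.
  by rewrite mulr_gt0//; move: clo; lra.
by lra.
Qed.

Lemma prototile_wide_corner_coords q :
  convex_vertices v q \/ concave_vertices v q -> wide_corner (prototile v) q.
Proof.
have y50 : 0 < y5 by rewrite /y5; move: c2lo; lra.
case=> [[[->|->]|->]|[->|->]].
- by rewrite v1; apply: wide_corner1; right.
- by rewrite v2; exact: wide_corner2.
- by rewrite v3; apply: wide_corner1; left.
- by rewrite v5 reflection_pt; apply: wide_corner5; rewrite gtr0_norm.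
- by rewrite v6 reflection_pt; apply: wide_corner5; rewrite normrN gtr0_norm.
Qed.

End PrototileCoordinates.

(** The sector of angle 2 pi / 3 fits in the inner angle, which is 5 pi / 7 at a
    convex vertex and 9 pi / 7 at a concave one. *)
Lemma prototile_wide_corner (R : realType) (v : nat -> plane R) q :
  regular_heptagon v ->
  convex_vertices v q \/ concave_vertices v q -> wide_corner (prototile v) q.
Proof.
move=> /heptagon_coords[ o [e [c [k [e0 cE cb kk [v0 v1 v2 v3 [v4 v5 v6]]]]]]].
exact: prototile_wide_corner_coords e0 cE cb kk v0 v1 v2 v3 v4 v5 v6 _.
Qed.

Lemma prototile_boundary_compact (R : realType) (v : nat -> plane R) :
  compact (prototile_boundary v).
Proof.
apply: compactU; first exact: polyline_compact.
apply: continuous_compact; last exact: polyline_compact.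
exact: continuous_subspaceT (@reflection_continuous _ _ _).
Qed.

Lemma prototile_closed (R : realType) (v : nat -> plane R) : closed (prototile v).
Proof. exact/enclosed_region_closed/prototile_boundary_compact. Qed.

Lemma prototile_bounded (R : realType) (v : nat -> plane R) : bounded_set (prototile v).
Proof. exact/enclosed_region_bounded/compact_bounded/prototile_boundary_compact. Qed.

(** * Area of open and closed sets *)

Section PlaneArea.
Variable R : realType.
Implicit Types (p : plane R) (A B : set (plane R)).

Let ball_measurable (x r : R) : measurable (ball x r : set (measurableTypeR R)).
Proof. by rewrite ball_itv; exact: measurable_itv. Qed.

(** The open squares with rational centres and radii form a countable base. *)
Lemma open_plane_measurable A : open A ->
  measurable (A : set (measurableTypeR R * measurableTypeR R)%type).
Proof.
move=> oA.
pose box (q : rat * rat * rat) : set (plane R) :=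
  ball (ratr q.1.1 : R) (ratr q.2) `*` ball (ratr q.1.2 : R) (ratr q.2).
pose F q := if pselect (box q `<=` A) then box q else set0.
have -> : A = \bigcup_q F q.
  apply/seteqP; split=> [p Ap|p [q _]]; last by rewrite /F; case: pselect => // qA /qA.
  have /nbhs_ballP[e /= e0 pA] : nbhs p A by exact: open_nbhs_nbhs.
  have [|r] := @rat_in_itvoo R 0 (e / 2); first by rewrite divr_gt0.
  rewrite in_itv/= => /andP[r0 re].
  have rat_near (x : R) : exists a : rat, `|ratr a - x| < ratr r.
    have [|a] := @rat_in_itvoo R (x - ratr r) (x + ratr r); first by lra.
    by rewrite in_itv/= => /andP[a1 a2]; exists a; rewrite ltr_norml; apply/andP; split; lra.
  have [a pa] := rat_near p.1; have [b pb] := rat_near p.2.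
  exists (a, b, r) => //; rewrite /F; case: pselect => [sub|nsub].
    by split; rewrite /= -ball_normE /=.
  exfalso; apply: nsub => q [] /=; rewrite -!ball_normE /= => qa qb; apply: pA; split; rewrite -ball_normE /=.
  - by move: qa pa; rewrite !ltr_norml => /andP[? ?] /andP[? ?]; apply/andP; split; lra.
  - by move: qb pb; rewrite !ltr_norml => /andP[? ?] /andP[? ?]; apply/andP; split; lra.
apply: countable_bigcupT_measurable => [|q]; first exact: countableP.
rewrite /F; case: pselect => [sub|nsub]; last exact: measurable0.
by apply: measurableX; exact: ball_measurable.
Qed.

Lemma closed_plane_measurable A : closed A ->
  measurable (A : set (measurableTypeR R * measurableTypeR R)%type).
Proof.
by move=> clA; rewrite -[A]setCK; apply: measurableC; exact: open_plane_measurable (closed_openC clA).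
Qed.

Lemma area_open_gt0 A : open A -> A !=set0 -> (0 < area A)%E.
Proof.
move=> oA [p Ap]; have /nbhs_ballP[e /= e0 pA] : nbhs p A by exact: open_nbhs_nbhs.
have ballE : ball p e = ball p.1 e `*` ball p.2 e by [].
apply: (@lt_le_trans _ _ (area (ball p.1 e `*` ball p.2 e))).
  have -> : area (ball p.1 e `*` ball p.2 e) = (e *+ 2 * (e *+ 2))%:E.
    rewrite /area product_measure1E; try exact: ball_measurable.
    by rewrite EFinM; congr (_ * _)%E; exact: lebesgue_measure_ball (ltW e0).
  by rewrite lte_fin mulr_gt0// pmulrn_lgt0.
apply: le_measure; rewrite ?inE.
- by apply: measurableX; exact: ball_measurable.
- exact: open_plane_measurable.
- by rewrite -ballE.
Qed.

Lemma area_interiors_disjoint A B : closed A -> closed B ->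
  area (A `&` B) = 0%E -> ~ (A° `&` B° !=set0).
Proof.
move=> clA clB AB0 meet.
have oAB : open (A° `&` B°) by apply: openI; exact: open_interior.
suff : (area (A° `&` B°) <= area (A `&` B))%E.
  by rewrite AB0 leNgt area_open_gt0.
apply: le_measure; rewrite ?inE.
- exact: open_plane_measurable.
- by apply: closed_plane_measurable; exact: closedI.
- by apply: setISS; exact: interior_subset.
Qed.

End PlaneArea.

(** * Endpoints of an arc *)

Section ArcEndpoints.
Variable R : realType.
Implicit Types (g h : R -> plane R) (A : set (plane R)) (p : plane R).

(** An inner point of an arc disconnects it, whereas the arc stays connected when
    an endpoint is removed. *)
Lemma arc_inner_not_end g h A (t b : R) :
  arc_parametrization g A -> arc_parametrization h A ->
  0 < t < 1 -> b = 0 \/ b = 1 -> h b <> g t.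
Proof.
move=> [gc gi gA] [hc hi hA] /andP[t0 t1] b01 hg.
have bI : 0 <= b <= 1 by case: b01 => ->; rewrite lexx ler01.
pose J : set R := [set s | 0 <= s <= 1 /\ s <> b].
have J_itv : is_interval J.
  move=> x y [/andP[x0 x1] xb] [/andP[y0 y1] yb] z /andP[xz zy]; split.
    by rewrite (le_trans x0)// (le_trans zy).
  by move=> zb; case: b01 => bE; [apply: xb|apply: yb]; lra.
have gI (s u : R) : 0 <= s <= 1 -> 0 <= u <= 1 -> g s = g u -> s = u.
  by move=> sI uI; apply: gi; rewrite in_itv.
have Ag s : 0 <= s <= 1 -> A (g s) by move=> sI; rewrite -gA; exists s => //=; rewrite in_itv.
pose C := h @` J.
have CE p : C p <-> A p /\ p <> g t.
  split=> [[s [sI sb] <-]|[]].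
    split; first by rewrite -hA; exists s => //=; rewrite in_itv.
    by rewrite -hg => /hi E; apply: sb; apply: E; rewrite in_itv.
  rewrite -hA => -[s /=]; rewrite in_itv/= => sI <- hst; exists s => //; split=> //.
  by move=> sb; apply: hst; rewrite sb.
have C_conn : connected C.
  apply: connected_continuous_connected; first exact/connected_intervalP.
  by apply: continuous_subspaceW hc => s [sI _] /=; rewrite in_itv.
have img_closed (x y : R) : 0 <= x -> y <= 1 -> closed (g @` `[x, y]).
  move=> x0 y1; apply: compact_closed; first exact: norm_hausdorff.
  apply: continuous_compact; last exact: segment_compact.
  apply: continuous_subspaceW gc => s /=; rewrite !in_itv/= => /andP[xs sy].
  by rewrite (le_trans x0) ?(le_trans sy).
have endC s : 0 <= s <= 1 -> s <> t -> C (g s).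
  move=> sI st; apply/CE; split; first exact: Ag.
  by move/gI => /(_ sI) E; apply: st; apply: E; rewrite !ltW.
have BC : C `&` g @` `[0, t] = C.
  apply: C_conn.
  - exists (g 0); split; first by apply: endC; [rewrite lexx ler01|lra].
    by exists 0 => //=; rewrite in_itv/= lexx ltW.
  - exists (~` (g @` `[t, 1])); first by apply: closed_openC; apply: img_closed => //; exact: ltW.
    apply/seteqP; split=> p [Cp].
      move=> [s /=]; rewrite in_itv/= => /andP[s0 st] sp; split=> // -[u /=].
      rewrite in_itv/= => /andP[tu u1] up; have /CE[_] := Cp; apply.
      have su : s = u.
        by apply: gI; rewrite ?up ?s0 ?u1 ?(le_trans st (ltW t1)) ?(le_trans (ltW t0) tu).
      by rewrite -sp; congr g; apply/eqP; rewrite eq_le st su tu.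
    have /CE[+ _] := Cp; rewrite -gA => -[s /=]; rewrite in_itv/= => /andP[s0 s1] sp nst.
    split=> //; exists s => //=; rewrite in_itv/= s0 leNgt; apply/negP => ts.
    by apply: nst; exists s => //=; rewrite in_itv/= s1 ltW.
  - by exists (g @` `[0, t]) => //; apply: img_closed => //; exact: ltW.
have : C (g 1) by apply: endC; [rewrite lexx ler01|lra].
rewrite -BC => -[_ [s /=]]; rewrite in_itv/= => /andP[s0 st] s1.
have sE : s = 1 by apply: gI; rewrite ?lexx ?ler01 ?s0 ?(le_trans st (ltW t1)).
by have := le_lt_trans st t1; rewrite sE ltxx.
Qed.

Lemma arc_endpointE g A p : arc_parametrization g A -> arc_endpoint A p ->
  p = g 0 \/ p = g 1.
Proof.
move=> gP [h [hP pE]].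
have [b b01 pb] : exists2 b : R, b = 0 \/ b = 1 & p = h b.
  by case: pE => ->; [exists 0; [left|]|exists 1; [right|]].
have : A p.
  case: (hP) => _ _ <-; exists b => //=; rewrite in_itv/=.
  by case: b01 => ->; rewrite lexx ler01.
case: (gP) => _ _ <- [t /=]; rewrite in_itv/= => /andP[t0 t1] gt.
have [t00|t00] := eqVneq t 0; first by left; rewrite -gt t00.
have [t11|t11] := eqVneq t 1; first by right; rewrite -gt t11.
have : h b <> g t by apply: arc_inner_not_end gP hP _ b01; rewrite !lt_neqAle eq_sym t00 t0 t11.
by rewrite gt pb.
Qed.

End ArcEndpoints.

(** * Chains of arcs and integer intervals *)

(** Arcs numbered by nat are joined into a chain indexed by integers. The arc n
    has the two endpoints P n false and P n true; each point is an endpoint of at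
    most two arcs, and each arc but the first has an endpoint on an earlier one. *)
Section Chain.
Variables (X : eqType) (P : nat -> bool -> X).
Hypothesis two_arcs : forall i j k a b d,
  P i a = P j b -> P j b = P k d -> [\/ i = j, j = k | i = k].
Hypothesis attached : forall n, exists j a b, (j < n.+1)%N /\ P n.+1 a = P j b.

(** The pair x = (n, b) stands for the arc n oriented from P n b to P n (~~ b). *)
Definition first_end (x : nat * bool) := P x.1 x.2.
Definition last_end (x : nat * bool) := P x.1 (~~ x.2).

(** The arcs 0, ..., n form the chain s, indexed by the integers of [-l, r]: each
    of them occurs exactly once, and consecutive arcs are joined. *)
Definition chain_of (n : nat) (l r : nat) (s : int -> nat * bool) :=
  [/\ (l + r)%N = n,
    forall k : int, - l%:Z <= k <= r%:Z -> ((s k).1 <= n)%N,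
    forall j k : int, - l%:Z <= j <= r%:Z -> - l%:Z <= k <= r%:Z ->
      (s j).1 = (s k).1 -> j = k,
    forall m, (m <= n)%N -> exists2 k : int, - l%:Z <= k <= r%:Z & (s k).1 = m &
    forall k : int, - l%:Z <= k < r%:Z -> last_end (s k) = first_end (s (k + 1))].

(** A state (l, r, s) describes a chain; the chain of st' prolongs that of st. *)
Definition extends (st st' : nat * nat * (int -> nat * bool)) :=
  [/\ (st.1.1 <= st'.1.1)%N, (st.1.2 <= st'.1.2)%N &
    forall k : int, - st.1.1%:Z <= k <= st.1.2%:Z -> st'.2 k = st.2 k].

(** The new arc has an endpoint on an arc of the chain; as two consecutive arcs
    of the chain already occupy their common endpoint, it is attached to one of
    the two free ends. *)
Lemma chain_extend n l r s : chain_of n l r s ->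
  exists st, chain_of n.+1 st.1.1 st.1.2 st.2 /\ extends (l, r, s) st.
Proof.
move=> [lr s_le s_inj s_surj s_chain].
have [j [a [b [jn ab]]]] := attached n.
have [k /andP[lk kr] skj] := s_surj j jn.
have ends : P j b = first_end (s k) \/ P j b = last_end (s k).
  by rewrite /first_end /last_end skj; case: b {ab} (s k).2 => [] []; [left|right|right|left].
have free : P j b = last_end (s r) \/ P j b = first_end (s (- l%:Z)).
  case: ends => jb.
    have [<-|lk'] := eqVneq k (- l%:Z); [by right|exfalso].
    have k1 : - l%:Z <= k - 1 <= r%:Z by lia.
    have link : last_end (s (k - 1)) = first_end (s k).
      by rewrite s_chain ?subrK//; lia.
    have [||] := two_arcs ab (etrans jb (esym link)).
    - by move=> nj; move: jn; rewrite -nj ltnn.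
    - by rewrite -skj => jk; have := s_inj _ _ _ k1 jk; lia.
    - by move=> nj; have := s_le _ k1; rewrite -nj ltnn.
  have [<-|lk'] := eqVneq k r%:Z; [by left|exfalso].
  have k1 : - l%:Z <= k + 1 <= r%:Z by lia.
  have link : last_end (s k) = first_end (s (k + 1)) by rewrite s_chain//; lia.
  have [||] := two_arcs ab (etrans jb link).
  - by move=> nj; move: jn; rewrite -nj ltnn.
  - by rewrite -skj => jk; have := s_inj _ _ _ k1 jk; lia.
  - by move=> nj; have := s_le _ k1; rewrite -nj ltnn.
pose upd k0 x (i : int) : nat * bool := if i == k0 then x else s i.
case: free => jb.
  exists ((l, r.+1), upd r.+1%:Z (n.+1, a)); split; last first.
    by split=> //= i ir; rewrite /upd; case: eqP => // iE; lia.
  split=> /=; first by rewrite addnS lr.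
  - move=> i ir; rewrite /upd; case: eqP => //= ine.
    by rewrite leqW// s_le//; lia.
  - move=> i i' ir ir'; rewrite /upd; case: eqP => ie; case: eqP => ie' //=; try lia.
    + by move=> nE; have : ((s i').1 <= n)%N; [apply: s_le; lia|rewrite -nE ltnn].
    + by move=> nE; have : ((s i).1 <= n)%N; [apply: s_le; lia|rewrite nE ltnn].
    + by apply: s_inj; lia.
  - move=> m; rewrite leq_eqVlt => /predU1P[->|].
      by exists r.+1%:Z; [lia|rewrite /upd eqxx].
    by move=> /s_surj[i ir im]; exists i; [lia|rewrite /upd; case: eqP => // iE; lia].
  - move=> i ir; have [iE|iN] := eqVneq i r%:Z.
      rewrite iE /upd; case: eqP => [|_]; first lia.
      by case: eqP => [_|]; [rewrite -jb -ab|lia].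
    by rewrite /upd; case: eqP => [|_]; [lia|case: eqP => [|_]; [lia|apply: s_chain; lia]].
exists ((l.+1, r), upd (- l.+1%:Z) (n.+1, ~~ a)); split; last first.
  by split=> //= i ir; rewrite /upd; case: eqP => // iE; lia.
split=> /=; first by rewrite addSn lr.
- move=> i ir; rewrite /upd; case: eqP => //= ine.
  by rewrite leqW// s_le//; lia.
- move=> i i' ir ir'; rewrite /upd; case: eqP => ie; case: eqP => ie' //=; try lia.
  + by move=> nE; have : ((s i').1 <= n)%N; [apply: s_le; lia|rewrite -nE ltnn].
  + by move=> nE; have : ((s i).1 <= n)%N; [apply: s_le; lia|rewrite nE ltnn].
  + by apply: s_inj; lia.
- move=> m; rewrite leq_eqVlt => /predU1P[->|].
    by exists (- l.+1%:Z); [lia|rewrite /upd eqxx].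
  by move=> /s_surj[i ir im]; exists i; [lia|rewrite /upd; case: eqP => // iE; lia].
- move=> i ir; have [iE|iN] := eqVneq i (- l.+1%:Z).
    rewrite iE /upd eqxx; case: eqP => [|_]; first lia.
    have -> : - l.+1%:Z + 1 = - l%:Z by lia.
    by rewrite -jb -ab /last_end /= negbK.
  by rewrite /upd; case: eqP => [|_]; [lia|case: eqP => [|_]; [lia|apply: s_chain; lia]].
Qed.

(** The chains on more and more arcs extend each other, and their union contains
    all arcs; the index interval K is infinite on at least one side. *)
Lemma chain_exists : exists (K : set int) (s : int -> nat * bool),
  [/\ [/\ K 0, forall i j k : int, K i -> K k -> i <= j <= k -> K j &
        forall m : nat, exists2 k, K k & (m < `|k|)%N],
      forall j k, K j -> K k -> (s j).1 = (s k).1 -> j = k,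
      forall n, exists2 k, K k & (s k).1 = n &
      forall k, K k -> K (k + 1) -> last_end (s k) = first_end (s (k + 1))].
Proof.
have ch0 : chain_of 0 0 0 (fun=> (0%N, false)).
  split=> //= [j k jr kr _|m|k]; [lia| |lia].
  by rewrite leqn0 => /eqP->; exists 0.
pose next n st := if pselect (exists st', chain_of n.+1 st'.1.1 st'.1.2 st'.2 /\ extends st st')
  is left ex then projT1 (cid ex) else st.
pose st := fix st n := if n is m.+1 then next m (st m) else (0%N, 0%N, fun=> (0%N, false)).
have st_chain n : chain_of n (st n).1.1 (st n).1.2 (st n).2.
  elim: n => //= n IHn; rewrite /next; case: pselect => [ex|[]]; first by case: (cid ex) => ? [].
  by have := chain_extend IHn; case: (st n) => [[]].
have st_ext n : extends (st n) (st n.+1).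
  rewrite /= /next; case: pselect => [ex|[]]; first by case: (cid ex) => ? [].
  by have := chain_extend (st_chain n); case: (st n) => [[]].
have st_mono m n : (m <= n)%N -> extends (st m) (st n).
  elim: n => [|n IHn]; first by rewrite leqn0 => /eqP ->; split.
  rewrite leq_eqVlt => /predU1P[->|/IHn[l1 r1 e1]]; first by split.
  have [l2 r2 e2] := st_ext n; split; [exact: leq_trans l2|exact: leq_trans r2|].
  by move=> k kr; rewrite e2 ?e1//; lia.
pose rng n (k : int) := (- (st n).1.1%:Z <= k <= (st n).1.2%:Z).
have rng_mono m n k : (m <= n)%N -> rng m k -> rng n k.
  by move=> /st_mono[l1 r1 _]; rewrite /rng; lia.
pose K : set int := [set k | exists n, rng n k].
pose s k := if pselect (exists n, rng n k) is left ex then (st (projT1 (cid ex))).2 k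
  else (0%N, false).
have sE n k : rng n k -> s k = (st n).2 k.
  move=> nk; rewrite /s; case: pselect => [ex|[]]; last by exists n.
  case: (cid ex) => m mk /=; have [mn|/ltnW nm] := leqP m n.
    by have [_ _ ->] := st_mono _ _ mn.
  by have [_ _ ->] := st_mono _ _ nm.
have common j k : K j -> K k -> exists n, rng n j /\ rng n k.
  move=> [m mj] [n nk]; exists (maxn m n).
  by split; [apply: rng_mono mj|apply: rng_mono nk]; rewrite ?leq_maxl ?leq_maxr.
exists K, s; split.
- split; first by exists 0%N; rewrite /rng /=.
    move=> i j k iK kK ijk; have [n] := common i k iK kK.
    by rewrite /rng => -[ni nk]; exists n; rewrite /rng; lia.
  move=> m; have [lr _ _ _ _] := st_chain (m + m).+1.
  have [lm|ml] := leqP (st (m + m).+1).1.1 m.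
    exists (st (m + m).+1).1.2%:Z; last by rewrite absz_nat; lia.
    by exists (m + m).+1; rewrite /rng; lia.
  exists (- (st (m + m).+1).1.1%:Z); last by rewrite abszN absz_nat.
  by exists (m + m).+1; rewrite /rng; lia.
- move=> j k jK kK; have [n [nj nk]] := common _ _ jK kK.
  by rewrite (sE n j)// (sE n k)//; have [_ _ inj _ _] := st_chain n; exact: inj.
- move=> n; have [_ _ _ surj _] := st_chain n; have [k nk <-] := surj n (leqnn n).
  by exists k; [exists n|rewrite (sE n)].
- move=> k kK k1K; have [n [nk nk1]] := common _ _ kK k1K.
  rewrite (sE n k)// (sE n (k + 1))//; have [_ _ _ _ chn] := st_chain n.
  by apply: chn; move: nk nk1; rewrite /rng; lia.
Qed.

(** In an infinite chain, two arcs have a common endpoint only where they are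
    joined: any other coincidence involves a third arc, or closes up the chain
    from a first arc to a last one. *)
Lemma chain_simple (K : set int) (s : int -> nat * bool) :
  (forall n, P n false <> P n true) ->
  (forall i j k : int, K i -> K k -> i <= j <= k -> K j) ->
  (forall m : nat, exists2 k, K k & (m < `|k|)%N) ->
  (forall j k, K j -> K k -> (s j).1 = (s k).1 -> j = k) ->
  (forall k, K k -> K (k + 1) -> last_end (s k) = first_end (s (k + 1))) ->
  forall j k a d, K j -> K k -> j < k -> P (s j).1 a = P (s k).1 d ->
  [/\ k = j + 1, a = ~~ (s j).2 & d = (s k).2].
Proof.
move=> P_inj K_itv K_inf s_inj s_link j k a d jK kK jk E.
have distinct3 i1 i2 i3 b1 b2 b3 : K i1 -> K i2 -> K i3 -> i1 < i2 -> i2 < i3 ->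
    P (s i1).1 b1 = P (s i2).1 b2 -> P (s i2).1 b2 = P (s i3).1 b3 -> False.
  move=> K1 K2 K3 i12 i23 e12 e23.
  by case: (two_arcs e12 e23) => /s_inj e; [have := e K1 K2|have := e K2 K3|have := e K1 K3]; lia.
have ends_neq i : first_end (s i) <> last_end (s i).
  rewrite /first_end /last_end; case: (s i) => n b; case: b => /=; last exact: P_inj.
  by move=> /esym; exact: P_inj.
have side (b b' : bool) : b = b' \/ b = ~~ b' by case: b; case: b'; [left|right|right|left].
have k1K : K (k - 1) by apply: (K_itv _ _ _ jK kK); lia.
have link_k : last_end (s (k - 1)) = first_end (s k).
  by rewrite s_link ?subrK.
have [d0|d1] := side d (s k).2.
  have Ek : P (s j).1 a = first_end (s k) by rewrite E d0.
  have [kj|kj] := eqVneq (k - 1) j; last first.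
    by exfalso; apply: (distinct3 j (k - 1) k) (jK) (k1K) (kK) _ _ (etrans Ek (esym link_k)) link_k; lia.
  split=> //; first lia.
  have [a0|//] := side a (s j).2; exfalso; apply: (ends_neq j).
  by rewrite -{2}kj link_k -Ek a0.
have Ek : P (s j).1 a = last_end (s k) by rewrite E d1.
have k2K : ~ K (k + 1).
  move=> k2K; apply: (distinct3 j k (k + 1)) (jK) (kK) (k2K) jk _ Ek (s_link _ kK k2K); lia.
have [a0|a1] := side a (s j).2; last first.
  have j1K : K (j + 1) by apply: (K_itv _ _ _ jK kK); lia.
  have link_j := s_link _ jK j1K.
  have Ej : last_end (s j) = last_end (s k) by rewrite -Ek a1.
  have [jk1|jk1] := eqVneq (j + 1) k.
    by exfalso; apply: (ends_neq k); rewrite -Ej -{1}jk1.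
  exfalso; apply: (distinct3 j (j + 1) k) (jK) (j1K) (kK) _ _ link_j (etrans (esym link_j) Ej); lia.
have Ej : first_end (s j) = last_end (s k) by rewrite -Ek a0.
have j0K : ~ K (j - 1).
  move=> j0K; have link_j : last_end (s (j - 1)) = first_end (s j) by rewrite s_link ?subrK.
  apply: (distinct3 (j - 1) j k) (j0K) (jK) (kK) _ jk link_j Ej; lia.
exfalso; have [i iK im] := K_inf (`|j| + `|k|)%N.
have [ij|ji] := ltP i j; first by apply: j0K; apply: (K_itv _ _ _ iK jK); lia.
by apply: k2K; apply: (K_itv _ _ _ kK iK); lia.
Qed.

End Chain.

(** An injective self-map phi of an integer interval which preserves adjacency is
    a translation, provided that phi (phi j) <> j for all j: if phi reverses the
    order of two neighbours, then it is a reflection of the whole interval. *)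
Section AdjacencyPreserving.
Variables (K : set int) (phi : int -> int).
Hypothesis K_itv : forall i j k : int, K i -> K k -> i <= j <= k -> K j.
Hypothesis phi_K : forall k, K k -> K (phi k).
Hypothesis phi_inj : forall j k, K j -> K k -> phi j = phi k -> j = k.
Hypothesis phi_adj : forall k, K k -> K (k + 1) ->
  phi (k + 1) = phi k + 1 \/ phi (k + 1) = phi k - 1.

(** The step e between two neighbours propagates to the whole interval. *)
Let phi_step (e k : int) : e = 1 \/ e = - 1 -> K k -> K (k + 1) -> phi (k + 1) = phi k + e ->
  forall j, K j -> phi j = phi k + e * (j - k).
Proof.
move=> e1 kK k1K ke.
have up (n : nat) : K (k + n%:Z + 1) ->
    phi (k + n%:Z) = phi k + e * n%:Z /\ phi (k + n%:Z + 1) = phi k + e * (n%:Z + 1).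
  elim: n => [|n IHn] nK; first by rewrite addr0 mulr0 addr0 add0r mulr1.
  have n1K : K (k + n%:Z + 1) by apply: (K_itv kK nK); lia.
  have n0K : K (k + n%:Z) by apply: (K_itv kK nK); lia.
  have [h1 h2] := IHn n1K.
  have nE : k + n.+1%:Z = k + n%:Z + 1 by lia.
  rewrite nE in nK *; have eE : e * n.+1%:Z = e * n%:Z + e by lia.
  rewrite eE; split; first lia.
  have ne : phi (k + n%:Z) <> phi (k + n%:Z + 1 + 1).
    by move=> /(phi_inj n0K nK); lia.
  by case: (phi_adj n1K nK); lia.
have down (n : nat) : K (k - n%:Z) ->
    phi (k - n%:Z) = phi k - e * n%:Z /\ phi (k - n%:Z + 1) = phi k - e * n%:Z + e.
  elim: n => [|n IHn] nK; first by rewrite subr0 mulr0 subr0.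
  have n0K : K (k - n%:Z) by apply: (K_itv nK kK); lia.
  have n1K : K (k - n%:Z + 1) by apply: (K_itv nK k1K); lia.
  have [h1 h2] := IHn n0K.
  have nE : k - n%:Z = k - n.+1%:Z + 1 by lia.
  have eE : e * n.+1%:Z = e * n%:Z + e by lia.
  rewrite eE -nE; split; last lia.
  have ne : phi (k - n.+1%:Z) <> phi (k - n%:Z + 1).
    by move=> /(phi_inj nK n1K); lia.
  by rewrite nE in n0K h1 h2 ne *; case: (phi_adj nK n0K); lia.
move=> j jK; have [kj|jk] := ltP k j.
  have jE : j = k + (`|j - k|%N.-1)%:Z + 1 by lia.
  have [|_] := up (`|j - k|%N.-1); rewrite -jE // => ->.
  by congr (_ + e * _); lia.
have jE : j = k - `|k - j|%N%:Z by lia.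
have [|+ _] := down `|k - j|%N; rewrite -jE // => ->.
by rewrite -mulrN; congr (_ + e * _); lia.
Qed.

Lemma adjacency_translation k : (forall j, K j -> phi (phi j) <> j) ->
  K k -> K (k + 1) -> forall j, K j -> phi j = j + (phi k - k).
Proof.
move=> phi2 kK k1K j jK; have [ke|ke] := phi_adj kK k1K.
  by rewrite (phi_step (or_introl erefl) kK k1K ke jK); lia.
exfalso; apply: (phi2 k kK).
by rewrite (phi_step (or_intror erefl) kK k1K ke (phi_K kK)); lia.
Qed.

End AdjacencyPreserving.

(** A property invariant under a translation of an integer interval containing 0
    holds everywhere as soon as it holds on a window of radius |m| around 0. *)
Lemma translation_invariant (K : set int) (Q : int -> Prop) (m : int) :
  K 0 -> (forall i j k : int, K i -> K k -> i <= j <= k -> K j) -> m != 0 ->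
  (forall k, K k -> (`|k| <= `|m|)%N -> Q k) ->
  (forall k, K k -> K (k + m) -> (Q k <-> Q (k + m))) -> forall k, K k -> Q k.
Proof.
move=> K0 K_itv m0 Q0 Qm k; have [n kn] := ubnP `|k|%N.
elim: n k kn => // n IHn k kn kK; have [km|mk] := leqP `|k| `|m|; first exact: Q0.
have between j : (0 <= j <= k) || (k <= j <= 0) -> K j.
  by case/orP => h; [exact: K_itv K0 kK h|exact: K_itv kK K0 h].
have [same|opp] := leP (`|k - m|%N) `|k|%N.
  have mK : K (k - m) by apply: between; lia.
  have := Qm _ mK; rewrite subrK => /(_ kK) <-; apply: IHn => //; lia.
have mK : K (k + m) by apply: between; lia.
by apply/(Qm _ kK mK); apply: IHn => //; lia.
Qed.

(** * Concatenation of arcs *)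

(** A sequence of arcs G k, parametrized by [0, 1] and indexed by an interval K of
    integers, each of them ending where the next one begins. *)
Section Concatenation.
Variables (R : realType) (V : topologicalType).
Variables (K : set int) (G : int -> R -> V).
Hypothesis K_itv : forall i j k : int, K i -> K k -> i <= j <= k -> K j.
Hypothesis G_cont : forall k, K k -> {within `[0, 1], continuous (G k)}.
Hypothesis G_inj : forall k, K k -> {in `[0, 1] &, injective (G k)}.
Hypothesis G_link : forall k, K k -> K (k + 1) -> G k 1 = G (k + 1) 0.
(* Two arcs of the sequence meet only where they are joined. *)
Hypothesis G_simple : forall j k (t u : R), K j -> K k -> j < k ->
  0 <= t <= 1 -> 0 <= u <= 1 -> G j t = G k u -> [/\ k = j + 1, t = 1 & u = 0].

Let J : set R := \bigcup_(k in K) [set` `[k%:~R : R, (k + 1)%:~R]].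

(** On [k, k + 1] run through the arc G k; at the last point of J, if there is
    one, the floor is no longer in K, and the last arc is used. *)
Definition concatenation (t : R) : V :=
  let k := Num.floor t in
  let j := if pselect (K k) then k else k - 1 in G j (t - j%:~R).
Let c := concatenation.

Let concatenationE k t : K k -> k%:~R <= t <= (k + 1)%:~R -> c t = G k (t - k%:~R).
Proof.
move=> kK /andP[kt]; rewrite le_eqVlt => /predU1P[tE|tk].
  have fE : Num.floor t = k + 1 by rewrite tE intrKfloor.
  rewrite /c /concatenation fE; case: pselect => [k1K|_] /=; last by rewrite addrK.
  by rewrite tE subrr -G_link// intrD [k%:~R + _]addrC addrK.
have fE : Num.floor t = k by apply: floor_def; rewrite kt.
by rewrite /c /concatenation fE; case: pselect.
Qed.

Let J_itv : is_interval J.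
Proof.
move=> x y [j jK /=]; rewrite in_itv/= => /andP[jx xj] [k kK /=].
rewrite in_itv/= => /andP[ky yk] z /andP[xz zy].
have /andP[fz zf] := floor_itv z.
have jf : j <= Num.floor z by rewrite floor_ge_int; exact: le_trans jx xz.
have fk : Num.floor z <= k + 1 by rewrite -[leRHS](@intrKfloor R); apply: le_floor; exact: le_trans zy yk.
have [fk'|fk'] := leP (Num.floor z) k.
  exists (Num.floor z); last by rewrite /= in_itv/= fz ltW.
  by apply: (K_itv jK kK); rewrite jf.
have fE : Num.floor z = k + 1 by lia.
exists k => //=; rewrite in_itv/= (le_trans zy yk) andbT.
by apply: le_trans fz; rewrite fE ler_int; lia.
Qed.

Let int_near (k m : int) : m < k + 1 + 1 -> k - 1 < m + 1 ->
  [\/ m = k - 1, m = k | m = k + 1].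
Proof.
move=> m1 m2; have [mk|mk] := ltP m k; first by apply: Or31; lia.
by have [km|km] := ltP k m; [apply: Or33; lia|apply: Or32; lia].
Qed.

Let concatenation_continuous : {within J, continuous c}.
Proof.
apply/subspace_continuousP => x [m0 m0K m0x] U cU.
have arc_near m : \forall t \near x, K m -> m%:~R <= t <= (m + 1)%:~R -> U (c t).
  have [mK|] := pselect (K m); last by move=> nmK; near=> t.
  have [mx|nmx] := boolP (m%:~R <= x <= (m + 1)%:~R).
    have xm : `[0, 1]%classic (x - m%:~R).
      by move: mx; rewrite /= in_itv/= intrD => /andP[h1 h2]; apply/andP; split; lra.
    have cU' : nbhs (G m (x - m%:~R)) U by rewrite -concatenationE.
    have Gm : within `[0, 1] (nbhs (x - m%:~R)) (G m @^-1` U).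
      by move/subspace_continuousP: (G_cont mK) => /(_ _ xm) /(_ _ cU').
    have shift : (fun t : R => t - m%:~R) @ x --> x - m%:~R.
      by apply: cvgB; [exact: cvg_id|exact: cvg_cst].
    have near_x : nbhs x [set t | `[0, 1]%classic (t - m%:~R) -> U (G m (t - m%:~R))].
      exact: shift _ Gm.
    apply: (filterS _ near_x) => t Gt _ mt; rewrite (concatenationE mK mt); apply: Gt.
    by rewrite /= in_itv/=; move: mt; rewrite intrD => /andP[h1 h2]; apply/andP; split; lra.
  have : open (~` `[m%:~R : R, (m + 1)%:~R]%classic) by apply: closed_openC; exact: itv_closed.
  move=> oI; have : nbhs x (~` `[m%:~R : R, (m + 1)%:~R]%classic).
    by apply: open_nbhs_nbhs; split=> //=; rewrite in_itv/=; apply/negP.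
  by apply: filterS => t /= nt _ mt; case: nt; rewrite in_itv.
(* Near x only the arcs of indices k - 1, k and k + 1 matter. *)
pose k := Num.floor x; have /andP[fx xf] := floor_itv x.
have near1 : \forall t \near x, `|x - t| < 1 by exact: (nbhsx_ballx x 1).
suff : \forall t \near x, J t -> U (c t) by [].
near=> t.
have : `|x - t| < 1 by near: t.
rewrite ltr_norml => /andP[t1 t2].
have h1 : K (k + 1) -> (k + 1)%:~R <= t <= (k + 1 + 1)%:~R -> U (c t).
  by near: t; exact: arc_near.
have h2 : K k -> k%:~R <= t <= (k + 1)%:~R -> U (c t) by near: t; exact: arc_near.
have h3 : K (k - 1) -> (k - 1)%:~R <= t <= (k - 1 + 1)%:~R -> U (c t).
  by near: t; exact: arc_near.
move=> [m mK /=]; rewrite in_itv/= => mt.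
have m1 : m < k + 1 + 1.
  rewrite -(ltr_int R) !intrD; case/andP: mt => mt _; move: xf; rewrite -/k intrD; lra.
have m2 : k - 1 < m + 1.
  rewrite -(ltr_int R) !intrD; case/andP: mt => _; rewrite intrD; move: fx; rewrite -/k mulrN1z.
  by lra.
have [mE|mE|mE] : [\/ m = k - 1, m = k | m = k + 1].
  exact: int_near.
- by apply: h3; rewrite -mE.
- by apply: h2; rewrite -mE.
- by apply: h1; rewrite -mE.
Unshelve. all: by end_near. Qed.

Let concatenation_lt_neq x y : J x -> J y -> x < y -> c x <> c y.
Proof.
move=> [j jK /=]; rewrite in_itv/= => jx [k kK /=]; rewrite in_itv/= => ky xy.
rewrite (concatenationE jK jx) (concatenationE kK ky) => E.
have sub01 (m : int) (z : R) : m%:~R <= z <= (m + 1)%:~R -> 0 <= z - m%:~R <= 1.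
  by rewrite intrD => /andP[h1 h2]; apply/andP; split; lra.
case: (ltgtP j k) => jk.
- have [kE x1 y0] := G_simple jK kK jk (sub01 _ _ jx) (sub01 _ _ ky) E.
  by move: x1 y0 xy; rewrite kE intrD; lra.
- have [jE _ _] := G_simple kK jK jk (sub01 _ _ ky) (sub01 _ _ jx) (esym E).
  by move: jx ky xy; rewrite jE => /andP[+ _] /andP[_]; lra.
- move: E jx; rewrite jk => /(G_inj kK) E jx.
  have := E; rewrite !in_itv/= => /(_ (sub01 _ _ jx) (sub01 _ _ ky)).
  by lra.
Qed.

(** The concatenation is an injective curve on the interval J. *)
Lemma concatenation_curve : exists c : R -> V,
  [/\ is_interval J, {within J, continuous c}, {in J &, injective c} &
    forall k, K k -> c @` [set` `[k%:~R : R, (k + 1)%:~R]] = G k @` `[0, 1]].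
Proof.
exists c; split; [exact: J_itv|exact: concatenation_continuous| |].
  move=> x y /set_mem xJ /set_mem yJ E; case: (ltgtP x y) => // xy.
    by have := concatenation_lt_neq xJ yJ xy.
  by have := concatenation_lt_neq yJ xJ xy; rewrite E.
move=> k kK; apply/seteqP; split=> x [t /=]; rewrite in_itv/= => tI <-.
  exists (t - k%:~R); last by rewrite (concatenationE kK tI).
  by move: tI; rewrite /= in_itv/= intrD => /andP[h1 h2]; apply/andP; split; lra.
have tk : k%:~R <= t + k%:~R <= (k + 1)%:~R.
  by move: tI; rewrite intrD => /andP[h1 h2]; apply/andP; split; lra.
by exists (t + k%:~R); [rewrite /= in_itv|rewrite (concatenationE kK tk) addrK].
Qed.

End Concatenation.

(** * Tilings obeying rule R1 *)

Section OrientedArcs.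
Variable R : realType.

Lemma within_continuous_reverse (V : topologicalType) (g : R -> V) :
  {within `[0, 1], continuous g} -> {within `[0, 1], continuous (fun t => g (1 - t))}.
Proof.
move=> /subspace_continuousP gc; apply/subspace_continuousP => x.
rewrite /= in_itv/= => /andP[x0 x1] U gU.
have x01 : `[0, 1]%classic (1 - x) by rewrite /= in_itv/=; apply/andP; split; lra.
have near1 : within `[0, 1] (nbhs (1 - x)) (g @^-1` U) by exact: gc gU.
have rev : (fun t : R => 1 - t) @ x --> 1 - x.
  by apply: cvgB; [exact: cvg_cst|exact: cvg_id].
have near0 : nbhs x [set t | `[0, 1]%classic (1 - t) -> U (g (1 - t))] by exact: rev _ near1.
suff : nbhs x [set t | `[0, 1]%classic t -> U (g (1 - t))] by [].
apply: (filterS _ near0) => t Ut; rewrite /= in_itv/= => /andP[t0 t1]; apply: Ut.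
by rewrite /= in_itv/=; apply/andP; split; lra.
Qed.

(** For g a parametrization of an arc A, the image arc f @` A, run backwards when
    b is true. *)
Definition oriented_arc (f : plane R -> plane R) (g : R -> plane R) (b : bool) (t : R) :=
  f (g (if b then 1 - t else t)).

Lemma oriented_arc_parametrization f g A b : plane_isometry f ->
  arc_parametrization g A -> arc_parametrization (oriented_arc f g b) (f @` A).
Proof.
move=> fi [gc gi gA]; have [f' [_ fK _]] := isometry_inverse fi.
have dir (t : R) : t \in `[0, 1] -> (if b then 1 - t else t) \in `[0, 1].
  by rewrite !in_itv/= => /andP[t0 t1]; case: b; apply/andP; split; lra.
split.
- have hc : {within `[0, 1], continuous (fun t => g (if b then 1 - t else t))}.
    by case: b {dir} => //; exact: within_continuous_reverse.
  move/subspace_continuousP: hc => hc; apply/subspace_continuousP => x /hc gx.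
  by apply: cvg_comp gx _; exact: isometry_continuous.
- move=> t u t01 u01 /(can_inj fK) /gi; rewrite !dir// => /(_ erefl erefl).
  by case: b {dir} => // /(congr1 (fun x => 1 - x)); rewrite !opprB ![1 + _]addrC !subrK.
- rewrite -gA; apply/seteqP; split=> [_ [t t01 <-]|_ [_ [t t01 <-] <-]].
    by exists (g (if b then 1 - t else t)) => //; exists (if b then 1 - t else t) => //; exact: dir.
  exists (if b then 1 - t else t); first exact: dir.
  by rewrite /oriented_arc; case: b {dir}; rewrite ?opprB ?[1 + _]addrC ?subrK.
Qed.

End OrientedArcs.

(** No translation by a nonzero vector preserves a nonempty bounded set. *)
Lemma bounded_translate_eq (R : realType) (A : set (plane R)) (w : plane R) :
  A !=set0 -> bounded_set A -> (fun p => p + w) @` A = A -> w = 0.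
Proof.
move=> [p Ap] /bounded_setE[M AM] Aw.
have iter (n : nat) : A (p + n%:R *: w).
  elim: n => [|n IHn]; first by rewrite scale0r addr0.
  by rewrite -Aw; exists (p + n%:R *: w) => //; rewrite -addrA -natr1 scalerDl scale1r.
apply/eqP; rewrite -normr_eq0; apply/eqP/le_anti; rewrite normr_ge0 andbT leNgt.
apply/negP => w0.
have [n nM] : exists n : nat, M + `|p| < n%:R * `|w|.
  exists (Num.bound ((M + `|p|) / `|w|)); rewrite -ltr_pdivrMr//.
  by apply: archi_boundP; rewrite divr_ge0// addr_ge0// (le_trans _ (AM _ Ap)).
have := AM _ (iter n); have := ler_normB (p + n%:R *: w) p.
rewrite addrAC subrr add0r normrZ ger0_norm//; move: nM; lra.
Qed.

(** A tiling T obeying rule R1: s numbers the tiles in the order in which they are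
    placed, the isometry f n carries the prototile to the tile s n, and g
    parametrizes the marked arc of the prototile from its convex to its concave
    endpoint. *)
Section Tiling.
Variables (R : realType) (v : nat -> plane R) (M : set (plane R)) (T : set (marked_tile R)).
Variables (g : R -> plane R) (s : nat -> marked_tile R) (f : nat -> plane R -> plane R).
Hypothesis v_heptagon : regular_heptagon v.
Hypothesis g_arc : arc_parametrization g M.
Hypothesis g0 : convex_vertices v (g 0).
Hypothesis g1 : concave_vertices v (g 1).
Hypothesis g_inside : forall t : R, 0 < t < 1 -> (prototile v)° (g t).
Hypothesis T_cover : \bigcup_(t in T) tile_region t = setT.
Hypothesis T_overlap : forall t u, T t -> T u -> t <> u ->
  area (tile_region t `&` tile_region u) = 0%E.
Hypothesis s_bij : set_bij setT T s.
Hypothesis f_isometry : forall n, plane_isometry (f n).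
Hypothesis sE : forall n, s n = tile_image (f n) (MarkedTile (prototile v) M).
Hypothesis s_attached : forall n, (0 < n)%N -> exists2 j, (j < n)%N &
  exists p, arc_endpoint (tile_arc (s n)) p /\ arc_endpoint (tile_arc (s j)) p.

Let tile n := f n @` prototile v.
(** The endpoints of the arc of the tile n: the image of the convex one for
    b = false, of the concave one for b = true. *)
Let vertex n (b : bool) := f n (g (if b then 1 else 0)).

Let s_T n : T (s n). Proof. by case: s_bij => sT _ _; apply: sT. Qed.
Let s_inj n m : s n = s m -> n = m.
Proof. by case: s_bij => _ s_inj _; apply: s_inj; rewrite inE. Qed.
Let s_surj t : T t -> exists n, s n = t.
Proof. by case: s_bij => _ _ s_surj /s_surj[n _ <-]; exists n. Qed.

Let tiles_disjoint n m : n <> m -> ~ ((tile n)° `&` (tile m)° !=set0).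
Proof.
move=> nm; apply: area_interiors_disjoint.
- by apply: isometry_closed (f_isometry n) _; exact: prototile_closed.
- by apply: isometry_closed (f_isometry m) _; exact: prototile_closed.
- have := T_overlap (s_T n) (s_T m); rewrite !sE /=; apply.
  by rewrite -!sE => /s_inj.
Qed.

Let vertex_wide_corner n b : wide_corner (tile n) (vertex n b).
Proof.
apply: wide_corner_isometry (f_isometry n) _; apply: prototile_wide_corner => //.
by case: b; [right|left].
Qed.

(** At most two arcs end at a point of the plane. *)
Let two_arcs i j k a b d : vertex i a = vertex j b -> vertex j b = vertex k d ->
  [\/ i = j, j = k | i = k].
Proof.
move=> ij jk.
have [->|/eqP nij] := eqVneq i j; first by apply: Or31.
have [->|/eqP njk] := eqVneq j k; first by apply: Or32.
have [->|/eqP nik] := eqVneq i k; first by apply: Or33.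
have ci := vertex_wide_corner i a; have cj := vertex_wide_corner j b.
have ck := vertex_wide_corner k d; rewrite ij in ci; rewrite -jk in ck.
case: (three_wide_corners ci cj ck) => meet; exfalso.
- exact: tiles_disjoint nij meet.
- exact: tiles_disjoint nik meet.
- exact: tiles_disjoint njk meet.
Qed.

Let vertex_neq n : vertex n false <> vertex n true.
Proof.
have [f' [_ fK _]] := isometry_inverse (f_isometry n).
move=> /(can_inj fK); case: g_arc => _ gi _ /gi.
by rewrite !in_itv/= !lexx !ler01 => /(_ erefl erefl) /eqP; rewrite eq_sym oner_eq0.
Qed.

Let arc_interior n t : 0 < t < 1 -> (tile n)° (f n (g t)).
Proof. by move=> t01; apply: isometry_interior => //; exists (g t) => //; exact: g_inside. Qed.

(** An inner point of an arc is interior to its tile, hence on no other tile. *)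
Let arcs_meet_at_ends n m (t u : R) : n <> m -> 0 <= t <= 1 -> 0 <= u <= 1 ->
  f n (g t) = f m (g u) -> t = 0 \/ t = 1.
Proof.
move=> nm /andP[t0 t1] u01 E.
have [->|tn0] := eqVneq t 0; [by left|have [->|tn1] := eqVneq t 1; [by right|exfalso]].
have In : (tile n)° (f n (g t)) by apply: arc_interior; rewrite !lt_neqAle eq_sym tn0 tn1 t0.
have corner_case b : f m (g u) = vertex m b -> False.
  move=> ub; have := wide_corner_closure (vertex_wide_corner m b) (@open_interior _ (tile n)).
  by rewrite -ub -E => /(_ In) meet; apply: (tiles_disjoint nm); rewrite setIC.
have [u0|un0] := eqVneq u 0; first by apply: (corner_case false); rewrite u0.
have [u1|un1] := eqVneq u 1; first by apply: (corner_case true); rewrite u1.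
apply: (tiles_disjoint nm); exists (f n (g t)); split=> //; rewrite E.
apply: arc_interior; case/andP: u01 => u0 u1.
by rewrite !lt_neqAle eq_sym un0 un1 u0.
Qed.

Let tile_arc_endpoint n p : arc_endpoint (tile_arc (s n)) p -> exists b, p = vertex n b.
Proof.
rewrite sE => /(arc_endpointE (oriented_arc_parametrization false (f_isometry n) g_arc)).
by case=> ->; [exists false|exists true].
Qed.

Let attached n : exists j a b, (j < n.+1)%N /\ vertex n.+1 a = vertex j b.
Proof.
have [j jn [p [/tile_arc_endpoint[a pa] /tile_arc_endpoint[b pb]]]] := s_attached (ltn0Sn n).
by exists j, a, b; rewrite -pa -pb.
Qed.

(** The chain formed by all arcs: K is its index set, and num k gives the number of
    the k-th arc and its orientation. *)
Let K_spec := chain_exists two_arcs attached.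
Let K := projT1 (cid K_spec).
Let num := projT1 (cid (projT2 (cid K_spec))).

Let K_prop : [/\ [/\ K 0, forall i j k : int, K i -> K k -> i <= j <= k -> K j &
        forall m : nat, exists2 k, K k & (m < `|k|)%N],
      forall j k, K j -> K k -> (num j).1 = (num k).1 -> j = k,
      forall n, exists2 k, K k & (num k).1 = n &
      forall k, K k -> K (k + 1) -> last_end vertex (num k) = first_end vertex (num (k + 1))].
Proof. exact: (projT2 (cid (projT2 (cid K_spec)))). Qed.

(** The k-th arc of the chain, run in the direction of the chain. *)
Let G (k : int) := oriented_arc (f (num k).1) g (num k).2.

Let G0 k : G k 0 = first_end vertex (num k).
Proof. by rewrite /G /oriented_arc /first_end /vertex; case: (num k) => n []; rewrite /= ?subr0. Qed.
Let G1 k : G k 1 = last_end vertex (num k).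
Proof. by rewrite /G /oriented_arc /last_end /vertex; case: (num k) => n []; rewrite /= ?subrr. Qed.

Let G_arc k : arc_parametrization (G k) (tile_arc (s (num k).1)).
Proof. by rewrite sE; exact: oriented_arc_parametrization. Qed.

Let G_simple j k (t u : R) : K j -> K k -> j < k -> 0 <= t <= 1 -> 0 <= u <= 1 ->
  G j t = G k u -> [/\ k = j + 1, t = 1 & u = 0].
Proof.
have [[_ K_itv K_inf] num_inj _ link] := K_prop.
move=> jK kK jk t01 u01 E.
have njk : (num j).1 <> (num k).1 by move=> /(num_inj _ _ jK kK) jk'; move: jk; rewrite jk' ltxx.
have dir (x : R) (b : bool) : 0 <= x <= 1 -> 0 <= (if b then 1 - x else x) <= 1.
  by move=> /andP[x0 x1]; case: b; apply/andP; split; lra.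
have ends (i : int) (x : R) : (if (num i).2 then 1 - x else x) = 0 \/
   (if (num i).2 then 1 - x else x) = 1 -> x = 0 \/ x = 1.
  by case: (num i).2 => -[] h; [right|left|left|right]; lra.
have t1 := ends _ _ (arcs_meet_at_ends njk (dir _ _ t01) (dir _ _ u01) E).
have u1 := ends _ _ (arcs_meet_at_ends (nesym njk) (dir _ _ u01) (dir _ _ t01) (esym E)).
have simple := chain_simple two_arcs vertex_neq K_itv K_inf num_inj link jK kK jk.
move: E; case: t1 => ->; case: u1 => ->; rewrite ?G0 ?G1 => /simple [] //.
- by move=> _; case: (num j).2.
- by move=> _; case: (num j).2.
- by move=> _ _; case: (num k).2.
Qed.

Let G_link k : K k -> K (k + 1) -> G k 1 = G (k + 1) 0.
Proof. by have [_ _ _ link] := K_prop => kK k1K; rewrite G0 G1 link. Qed.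

Lemma arcs_form_curve : arcs_form_self_avoiding_curve T (\bigcup_(t in T) tile_arc t).
Proof.
have [[_ K_itv K_inf] num_inj num_surj _] := K_prop.
have [|||||c [J_itv c_cont c_inj cE]] := @concatenation_curve R _ K G.
- exact: K_itv.
- by move=> k _; case: (G_arc k).
- by move=> k _; case: (G_arc k).
- exact: G_link.
- exact: G_simple.
exists K, (fun k => s (num k).1), (\bigcup_(k in K) [set` `[k%:~R : R, (k + 1)%:~R]]), c.
have arcE k : K k -> c @` [set` `[k%:~R : R, (k + 1)%:~R]] = tile_arc (s (num k).1).
  by move=> kK; rewrite cE//; case: (G_arc k).
split=> //; first split=> //.
  split=> [k _|j k /set_mem jK /set_mem kK /s_inj|t /s_surj[n <-]]; first exact: s_T.
    exact: num_inj.
  by have [k kK <-] := num_surj n; exists k.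
split=> //; rewrite image_bigcup; apply/seteqP; split=> p.
  by move=> [k kK]; rewrite arcE// => kp; exists (s (num k).1).
move=> [t /s_surj[n <-]]; have [k kK <-] := num_surj n.
by exists k => //; rewrite arcE.
Qed.

Lemma tile_meets_arc t : T t -> (tile_region t `&` tile_arc t) !=set0.
Proof.
move=> /s_surj[n <-]; rewrite sE /=; exists (f n (g (1 / 2))); split.
  by apply: interior_subset; apply: arc_interior; apply/andP; split; lra.
exists (g (1 / 2)) => //; case: g_arc => _ _ <-; exists (1 / 2) => //=.
by rewrite in_itv/=; apply/andP; split; lra.
Qed.

(** The tile that carries the k-th arc of the chain. *)
Let region k := tile_region (s (num k).1).

Let region_bounded k : bounded_set (region k).
Proof.
rewrite /region sE /=; have /bounded_setE[B vB] := prototile_bounded v.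
have [a [b [tau [q [ab tau2 fE]]]]] := isometry_coords (f_isometry (num k).1).
pose e1 : plane R := (a, b); pose e2 : plane R := (- (tau * b), tau * a).
apply/bounded_setE; exists (`|q| + B * `|e1| + B * `|e2|) => _ [p /vB pB <-].
have -> : f (num k).1 p = q + p.1 *: e1 + p.2 *: e2.
  by rewrite fE; apply: injective_projections; rewrite /= /GRing.scale/=; ring.
have [p1 p2] : `|p.1| <= B /\ `|p.2| <= B.
  by move: pB; rewrite prod_normE ge_max => /andP[].
apply: le_trans (ler_normD _ _) _; rewrite normrZ lerD ?ler_wpM2r//.
by apply: le_trans (ler_normD _ _) _; rewrite normrZ lerD ?ler_wpM2r.
Qed.

Lemma tiling_nonperiodic : nonperiodic T.
Proof.
have [[K0 K_itv K_inf] num_inj num_surj _] := K_prop.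
move=> w w0 [_ Tw].
pose shift (p : plane R) := p + w.
have shiftE k : exists j, K k -> K j /\ s (num j).1 = tile_image shift (s (num k).1).
  have [kK|] := pselect (K k); last by exists 0.
  have /s_surj[n nE] := Tw _ (s_T (num k).1); have [j jK jn] := num_surj n.
  by exists j; rewrite jn.
(* The action of the translation on the indices. *)
have [phi phiE] := choice shiftE.
have phi_K k : K k -> K (phi k) by move=> /phiE[].
have phi_region k : K k -> region (phi k) = shift @` region k.
  by move=> /phiE[_]; rewrite /region => ->.
have phi_arc k : K k -> tile_arc (s (num (phi k)).1) = shift @` tile_arc (s (num k).1).
  by move=> /phiE[_] ->.
have shift_inj (A B : set (plane R)) : shift @` A = shift @` B -> A = B.
  move=> AB; apply/seteqP; split=> p Ap.
    have : (shift @` B) (shift p) by rewrite -AB; exists p.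
    by move=> [q Bq /addIr <-].
  have : (shift @` A) (shift p) by rewrite AB; exists p.
  by move=> [q Aq /addIr <-].
have phi_inj j k : K j -> K k -> phi j = phi k -> j = k.
  move=> jK kK jk; apply: num_inj => //; apply: s_inj.
  have := phi_region _ jK; rewrite jk phi_region// => /shift_inj rE.
  have := phi_arc _ jK; rewrite jk phi_arc// => /shift_inj aE.
  by move: rE aE; rewrite /region; case: (s _) => ? ?; case: (s _) => ? ? /= -> ->.
have region_neq0 k : region k !=set0.
  by have [p [kp _]] := tile_meets_arc (s_T (num k).1); exists p.
have phi1 k : K k -> phi k <> k.
  move=> kK kE; have := phi_region k kK; rewrite kE => /esym.
  move=> /(bounded_translate_eq (region_neq0 k) (@region_bounded k)) w00.
  by rewrite w00 eqxx in w0.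
have phi2 k : K k -> phi (phi k) <> k.
  move=> kK kE; have := phi_region _ (phi_K _ kK); rewrite kE phi_region// image_comp.
  have -> : shift \o shift = fun p => p + (w + w) by apply/funext => p; rewrite /shift /= addrA.
  move=> /esym /(bounded_translate_eq (region_neq0 k) (@region_bounded k)) ww.
  have : 2%:R *: w = 0 by rewrite scaler_nat mulr2n.
  by move/eqP; rewrite scaler_eq0 pnatr_eq0 (negbTE w0).
have phi_adj k : K k -> K (k + 1) -> phi (k + 1) = phi k + 1 \/ phi (k + 1) = phi k - 1.
  move=> kK k1K.
  have [t t01 tE] : exists2 t : R, 0 <= t <= 1 & G (phi k) t = shift (G k 1).
    have : tile_arc (s (num (phi k)).1) (shift (G k 1)).
      rewrite phi_arc//; exists (G k 1) => //; case: (G_arc k) => _ _ <-.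
      by exists 1 => //=; rewrite in_itv/= lexx ler01.
    by case: (G_arc (phi k)) => _ _ <- [t /=]; rewrite in_itv/= => ? ?; exists t.
  have [u u01 uE] : exists2 u : R, 0 <= u <= 1 & G (phi (k + 1)) u = shift (G k 1).
    have : tile_arc (s (num (phi (k + 1))).1) (shift (G k 1)).
      rewrite phi_arc//; exists (G k 1) => //; rewrite G_link//; case: (G_arc (k + 1)) => _ _ <-.
      by exists 0 => //=; rewrite in_itv/= lexx ler01.
    by case: (G_arc (phi (k + 1))) => _ _ <- [u /=]; rewrite in_itv/= => ? ?; exists u.
  have [kk|kk|/phi_inj kk] := ltgtP (phi k) (phi (k + 1)).
  - by left; have [->] := G_simple (phi_K _ kK) (phi_K _ k1K) kk t01 u01 (etrans tE (esym uE)).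
  - right; have [->] := G_simple (phi_K _ k1K) (phi_K _ kK) kk u01 t01 (etrans uE (esym tE)).
    by rewrite addrK.
  - by have := kk kK k1K; lia.
have [m [m0 phim]] : exists m, m != 0 /\ forall k, K k -> phi k = k + m.
  have [i iK i0] := K_inf 0%N.
  have [k [kK k1K]] : exists k, K k /\ K (k + 1).
    have [i_pos|i_neg] := ltP 0 i.
      by exists 0; split=> //; apply: (K_itv _ _ _ K0 iK); lia.
    by exists i; split=> //; apply: (K_itv _ _ _ iK K0); lia.
  exists (phi k - k); split; first by rewrite subr_eq0; apply/eqP; exact: phi1.
  exact: adjacency_translation phi2 kK k1K.
(* The linear form H is constant along w, hence bounded on the tiling. *)
pose H (p : plane R) := w.1 * p.2 - w.2 * p.1.
have Hw p : H (shift p) = H p by rewrite /H /shift /=; ring.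
pose Q C k := forall p, region k p -> `|H p| <= C.
have Q_mono C C' k : C <= C' -> Q C k -> Q C' k.
  by move=> CC Qk p /Qk /le_trans; apply.
have Q_one k : exists C, Q C k.
  have /bounded_setE[B kB] := region_bounded k; exists (`|w.1| * B + `|w.2| * B) => p /kB.
  rewrite prod_normE ge_max /H => /andP[p1 p2].
  by apply: le_trans (ler_normB _ _) _; rewrite !normrM lerD// ler_wpM2l.
have near (n : nat) : exists C, forall k, (`|k| < n)%N -> Q C k.
  elim: n => [|n [C CQ]]; first by exists 0.
  have [C1 Q1] := Q_one n%:Z; have [C2 Q2] := Q_one (- n%:Z).
  exists (Num.max C (Num.max C1 C2)) => k; rewrite ltnS leq_eqVlt => /orP[/eqP kn|/CQ].
    have [->|->] : k = n%:Z \/ k = - n%:Z by lia.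
      by apply: Q_mono Q1; rewrite !le_max lexx orbT.
    by apply: Q_mono Q2; rewrite !le_max lexx !orbT.
  by apply: Q_mono; rewrite le_max lexx.
have [C C0] := near `|m|%N.+1.
have CQ : forall k, K k -> Q C k.
  apply: (@translation_invariant K (Q C) m) => // [k _|k kK kmK]; first exact: C0.
  have rE := phi_region _ kK; rewrite phim// in rE.
  rewrite /Q /= rE; split=> [Qk _ [p kp <-]|Qk p kp]; first by rewrite Hw; exact: Qk.
  by rewrite -Hw; apply: Qk; exists p.
pose n2 := dotp w w.
have n2_gt0 : 0 < n2.
  rewrite lt_def addr_ge0 -?expr2 ?sqr_ge0// andbT; apply: contra w0.
  rewrite /n2 /dotp paddr_eq0 -?expr2 ?sqr_ge0// !sqrf_eq0 => /andP[/eqP w1 /eqP w2].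
  by apply/eqP/injective_projections.
(* A point where H exceeds its bound. *)
pose p : plane R := ((C + 1) / n2) *: (- w.2, w.1).
have : setT p by [].
rewrite -T_cover => -[t /s_surj[n <-]].
have [k kK <-] := num_surj n => /(CQ _ kK).
have -> : H p = C + 1.
  rewrite /H /p /= /GRing.scale /=; transitivity ((C + 1) / n2 * n2).
    by set q := _ / n2; rewrite /n2 /dotp; ring.
  by rewrite divfK// gt_eqF.
by rewrite ler_norml => /andP[_]; lra.
Qed.

End Tiling.

Theorem corollary2p5 (R : realType) (v : nat -> plane R)
    (M : set (plane R)) (T : set (marked_tile R)) :
  regular_heptagon v ->
  is_marking v M ->
  plane_tiling T ->
  tiled_by_copies (MarkedTile (prototile v) M) T ->
  rule_R1 T ->
  (exists C : set (plane R),
     arcs_form_self_avoiding_curve T C /\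
     forall t, T t -> (tile_region t `&` C) !=set0)
  /\ nonperiodic T.
Proof.
move=> v_heptagon [g [g_arc _ g0 g1 g_inside]] [_ T_cover T_overlap] T_copies.
move=> [s [s_bij s_attached]].
have copy n : exists f, plane_isometry f /\ s n = tile_image f (MarkedTile (prototile v) M).
  by case: s_bij => sT _ _; have [f fi fE] := T_copies _ (sT n I); exists f.
have [f fE] := choice copy.
have f_isometry n : plane_isometry (f n) by case: (fE n).
have sE n : s n = tile_image (f n) (MarkedTile (prototile v) M) by case: (fE n).
split.
  exists (\bigcup_(t in T) tile_arc t); split.
    exact: (arcs_form_curve v_heptagon g_arc g0 g1 g_inside T_overlap s_bij f_isometry sE
      s_attached).
  move=> t Tt; have [p [tp ap]] :=
    tile_meets_arc g_arc g_inside s_bij f_isometry sE Tt.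
  by exists p; split=> //; exists t.
exact: (tiling_nonperiodic v_heptagon g_arc g0 g1 g_inside T_cover T_overlap s_bij
  f_isometry sE s_attached).
Qed.
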